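(* Let $n\ge 3$ and let $\Gamma\subset\mathbb{R}^n$ be an open convex symmetric cone with vertex at the origin such that $\{\lambda:\lambda_i>0,\ 1\le i\le n\}\subset\Gamma\subset\{\lambda:\sum_{i=1}^n\lambda_i>0\}$. Assume that $(1,0,\ldots,0)\in\partial\Gamma$ and $0\le\mu_\Gamma^+<1$. Let $u\in LSC(B_1\setminus\{0\})\cap L^\infty_{\rm loc}(B_1\setminus\{0\})$ be a positive viscosity solution of $\lambda(A^u)\in\bar\Gamma$ in $B_1\setminus\{0\}$. Then either $u=\frac{C}{|x|^{n-2}}$ for some $C>0$, or $u$ can be extended to a positive function in $C^{0,1-\mu_\Gamma^+}_{\rm loc}(B_1)$. Moreover, in the latter case, there holds \[ \Big\|u^{\frac{\mu_\Gamma^+-1}{n-2}}\Big\|_{C^{0,1-\mu_\Gamma^+}(B_{1/2})}\le C(\Gamma)\,\sup_{\partial B_{3/4}}u^{\frac{\mu_\Gamma^+-1}{n-2}}, \] where $C(\Gamma)$ depends only on $\Gamma$.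
   Context: $B_r$ is the open ball of radius $r$ centered at the origin in $\mathbb{R}^n$; $LSC(\Omega)$ is the set of real-valued lower semicontinuous functions on $\Omega$. ''Symmetric'' means invariant under permutations of coordinates. For a positive $C^2$ function $u$, $A^u$ is the symmetric matrix with entries \[ (A^u)_{ij}=-\frac{2}{n-2}u^{-\frac{n+2}{n-2}}\nabla_{ij}u+\frac{2n}{(n-2)^2}u^{-\frac{2n}{n-2}}\nabla_iu\nabla_ju-\frac{2}{(n-2)^2}u^{-\frac{2n}{n-2}}|\nabla u|^2\delta_{ij}, \] and $\lambda(A^u)$ denotes its eigenvalues. Viscosity sense. Let $\Omega\subset\mathbb{R}^n$ be open. A positive function $u\in LSC(\Omega)$ satisfies $\lambda(A^u)\in\bar\Gamma$ in $\Omega$ in the viscosity sense if for any $x_0\in\Omega$ and $\varphi\in C^2(\Omega)$ with $(u-\varphi)(x_0)=0$ and $u-\varphi\ge 0$ near $x_0$, one has $\lambda(A^\varphi(x_0))\in\bar\Gamma$. The constant $\mu_\Gamma^+\in[0,n-1]$ is the unique number such that $(-\mu_\Gamma^+,1,\ldots,1)\in\partial\Gamma$. *)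

(* Defs.v *)
From HB Require Import structures.
From mathcomp Require Import all_boot all_order all_algebra all_fingroup.
From mathcomp Require Import all_classical all_reals all_analysis.

Set Implicit Arguments.
Unset Strict Implicit.
Unset Printing Implicit Defensive.

Import Order.TTheory GRing.Theory Num.Theory.
Import numFieldNormedType.Exports.

Local Open Scope classical_set_scope.
Local Open Scope ring_scope.

(* The library norm on 'rV[R]_n is the sup norm; it induces the usual topology,
   but balls and Hoelder quotients below use the Euclidean norm. *)
Definition enorm (R : realType) (n : nat) (x : 'rV[R]_n) : R :=
  Num.sqrt (\sum_(i < n) x 0 i ^+ 2).

Definition eball (R : realType) (n : nat) (r : R) : set 'rV[R]_n :=
  [set x | enorm x < r].
Arguments eball {R} n r.

Definition boundary (T : topologicalType) (A : set T) : set T :=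
  closure A `\` A°.

Definition is_cone (R : realType) (n : nat) (G : set 'rV[R]_n) : Prop :=
  forall (t : R) x, 0 < t -> G x -> G (t *: x).

Definition symmetric_set (R : realType) (n : nat) (G : set 'rV[R]_n) : Prop :=
  forall (s : 'S_n) x, G x -> G (col_perm s x).

(* (c, d, ..., d) *)
Definition head_tail (R : realType) (n : nat) (c d : R) : 'rV[R]_n :=
  \row_(i < n) (if (i : nat) == 0%N then c else d).

Definition is_mu_plus (R : realType) (n : nat) (G : set 'rV[R]_n) (mu : R) :
    Prop :=
  0 <= mu <= n%:R - 1 /\ boundary G (head_tail n (- mu) 1).

Definition partial (R : realType) (n : nat) (i : 'I_n) (f : 'rV[R]_n -> R) :
    'rV[R]_n -> R :=
  fun x => 'D_(delta_mx 0 i) f x.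

Definition C1_on (R : realType) (n : nat) (O : set 'rV[R]_n)
    (f : 'rV[R]_n -> R) : Prop :=
  forall (i : 'I_n) x, O x ->
    derivable f x (delta_mx 0 i) /\ {for x, continuous (partial i f)}.

(* For O open: all partial derivatives of order 1 and 2 exist and are
   continuous in O. *)
Definition C2_on (R : realType) (n : nat) (O : set 'rV[R]_n)
    (f : 'rV[R]_n -> R) : Prop :=
  C1_on O f /\ forall i : 'I_n, C1_on O (partial i f).

Definition gradient (R : realType) (n : nat) (f : 'rV[R]_n -> R)
    (x : 'rV[R]_n) : 'rV[R]_n :=
  \row_(i < n) partial i f x.

Definition conformal_mx (R : realType) (n : nat) (f : 'rV[R]_n -> R)
    (x : 'rV[R]_n) : 'M[R]_n :=
  let m : R := n%:R in
  \matrix_(i < n, j < n)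
    (- (2 / (m - 2)) * f x `^ (- ((m + 2) / (m - 2)))
       * partial i (partial j f) x
     + 2 * m / (m - 2) ^+ 2 * f x `^ (- (2 * m / (m - 2)))
       * (partial i f x * partial j f x)
     - 2 / (m - 2) ^+ 2 * f x `^ (- (2 * m / (m - 2)))
       * enorm (gradient f x) ^+ 2 * (i == j)%:R).

(* lambda(A) lies in S: the eigenvalues are listed with multiplicity, as the
   roots of the characteristic polynomial, in an order that is immaterial when
   S is symmetric. *)
Definition eigenvalues_in (R : realType) (n : nat) (A : 'M[R]_n)
    (S : set 'rV[R]_n) : Prop :=
  exists l : 'rV[R]_n,
    char_poly A = \prod_(i < n) ('X - (l 0 i)%:P) /\ S l.

Definition viscosity_in (R : realType) (n : nat) (G O : set 'rV[R]_n)
    (u : 'rV[R]_n -> R) : Prop :=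
  forall (x0 : 'rV[R]_n) (phi : 'rV[R]_n -> R),
    O x0 -> C2_on O phi ->
    u x0 - phi x0 = 0 ->
    (\forall x \near x0, 0 <= u x - phi x) ->
    eigenvalues_in (conformal_mx phi x0) (closure G).

Definition LSC_on (R : realType) (n : nat) (O : set 'rV[R]_n)
    (u : 'rV[R]_n -> R) : Prop :=
  @lower_semicontinuous (subspace O) R (EFin \o u).

(* Null sets of n-dimensional Lebesgue measure, by countable covers with open
   boxes. *)
Definition lebesgue_null (R : realType) (n : nat) (N : set 'rV[R]_n) : Prop :=
  forall e : R, 0 < e ->
    exists a b : nat -> 'rV[R]_n,
      [/\ forall k i, a k 0 i <= b k 0 i,
          N `<=` \bigcup_k [set x | forall i, a k 0 i < x 0 i < b k 0 i]
        & (\sum_(0 <= k <oo) (\prod_(i < n) (b k 0 i - a k 0 i))%:E <= e%:E)%E].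

(* Essential boundedness on compact subsets; no measurability is required of u,
   as it is only used together with lower semicontinuity. *)
Definition Linfty_loc (R : realType) (n : nat) (O : set 'rV[R]_n)
    (u : 'rV[R]_n -> R) : Prop :=
  forall K : set 'rV[R]_n, compact K -> K `<=` O ->
    exists M : R, lebesgue_null [set x | K x /\ M < `|u x|].

(* The C^{0,a} norm on A, possibly +oo; the pairs with x = y contribute 0 to
   the seminorm since the numerator vanishes. *)
Definition holder_norm (R : realType) (n : nat) (a : R) (A : set 'rV[R]_n)
    (f : 'rV[R]_n -> R) : \bar R :=
  (ereal_sup [set `|f x|%:E | x in A] +
   ereal_sup [set (`|f p.1 - f p.2| / enorm (p.1 - p.2) `^ a)%:E
             | p in A `*` A])%E.

Definition holder_loc (R : realType) (n : nat) (a : R) (O : set 'rV[R]_n)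
    (f : 'rV[R]_n -> R) : Prop :=
  forall K : set 'rV[R]_n, compact K -> K `<=` O ->
    (holder_norm a K f < +oo)%E.

(* v is an extension of u from B_1 \ {0} to a positive function of class
   C^{0,a}_loc(B_1). *)
Definition positive_holder_extension (R : realType) (n : nat) (a : R)
    (u v : 'rV[R]_n -> R) : Prop :=
  [/\ forall x, (eball n 1 `\ 0) x -> v x = u x,
      forall x, eball n 1 x -> 0 < v x
    & holder_loc a (eball n 1) v].

(* Main.v *)
(* Put b = 1 - mu and V = u^(-b/(n-2)).  If V is touched from above at x by h(|x - y|^2),
   then u is touched from below by a quadratic polynomial in |x - y|^2, for which A is a
   scalar matrix plus a rank-one matrix.  The two boundary points (1,0,...,0) and
   (-mu,1,...,1) of the cone then yield, for h as a function of r = |x - y|,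
   0 <= r h' <= b h and h'' + (1 - b) h'/r >= 0; the functions c + a r^b are the extremal
   ones.  Comparison with them around y gives V(x) <= V(y) + (M - V(y)) (|x - y|/r)^b, where
   M bounds V on the ball of radius r about y: both the interior Hoelder estimate and, for
   M - V, a Harnack inequality.  Around the origin, the maximum S(r) of V over the sphere of
   radius r is nondecreasing with some limit v0, and V <= v0 + C r^b; the Harnack inequality
   along spheres turns this into |V - v0| <= C r^b.  If v0 > 0 this is the Hoelder extension.
   If v0 = 0, then S(r)/r^b is nondecreasing by comparison and nonincreasing since
   r h' <= b h, hence constant; so u lies above a multiple of |x|^(2-n) which it touches on
   every sphere.  As u is superharmonic (the trace is nonnegative on the cone), Hopf's
   barrier argument forces equality. *)
Require Import Defs.
From mathcomp Require Import all_boot all_order all_algebra all_fingroup.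
From mathcomp Require Import all_classical all_reals all_analysis.
From mathcomp Require Import ring lra.
Import Order.TTheory GRing.Theory Num.Theory.
Import numFieldNormedType.Exports.
Local Open Scope classical_set_scope.
Local Open Scope ring_scope.

Set Implicit Arguments.
Unset Strict Implicit.
Unset Printing Implicit Defensive.

(** * Euclidean geometry of row vectors *)

(** The exponent of V is the one for which the squared first derivatives of h cancel: the
    second-order condition that remains is linear in h and holds with equality for c + a r^b.
    Comparison needs strict failure, and each of the three conditions supplies its own perturbation.
    A small multiple of -r^2 breaks the second-order condition. A decreasing exponential breaks h'
    >= 0, so that a bound on the outer sphere alone controls the inside and nothing need be known
    near the centre. A factor increasing in r breaks r h' <= b h, so that a bound on an inner sphere
    alone controls the outside. As the comparison functions are smooth off their centre, it suffices
    to look at an extremum of a semicontinuous function on a closed annulus. The test functions of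
    the viscosity condition must however be C^2 on the whole domain, where r^b may be singular;
    second-order Taylor polynomials in r^2 take the place of h. All constants of the estimate are
    explicit in b = 1 - mu, hence fixed before u. *)

Section EuclideanNorm.
Variables (R : realType) (n : nat).
Implicit Types x y z : 'rV[R]_n.

Lemma enorm_ge0 x : 0 <= enorm x.
Proof. exact: sqrtr_ge0. Qed.

Lemma enorm_sqr x : enorm x ^+ 2 = \sum_(i < n) x 0 i ^+ 2.
Proof. by rewrite sqr_sqrtr// sumr_ge0// => i _; rewrite sqr_ge0. Qed.

Lemma enorm0 : enorm (0 : 'rV[R]_n) = 0.
Proof.
apply/eqP; rewrite -sqrf_eq0 enorm_sqr big1 // => i _.
by rewrite mxE expr0n.
Qed.

Lemma enorm_eq0 x : enorm x = 0 -> x = 0.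
Proof.
move=> x0; have : \sum_(i < n) x 0 i ^+ 2 == 0 by rewrite -enorm_sqr x0 expr0n.
rewrite psumr_eq0; last by move=> i _; rewrite sqr_ge0.
move=> /allP h; apply/rowP => i; rewrite mxE; apply/eqP.
by rewrite -sqrf_eq0; apply: h; rewrite mem_index_enum.
Qed.

Lemma enorm_gt0 x : (0 < enorm x) = (x != 0).
Proof.
rewrite lt_def enorm_ge0 andbT; congr (~~ _).
by apply/idP/idP => /eqP => [/enorm_eq0 ->|->]; rewrite ?enorm0.
Qed.

Lemma enormZ (a : R) x : enorm (a *: x) = `|a| * enorm x.
Proof.
rewrite /enorm -[`|a|]sqrtr_sqr -sqrtrM ?sqr_ge0// mulr_sumr.
congr (Num.sqrt _).
by apply: eq_bigr => i _; rewrite mxE exprMn.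
Qed.

Lemma enormN x : enorm (- x) = enorm x.
Proof. by rewrite -scaleN1r enormZ normrN1 mul1r. Qed.

Lemma enorm_distC x y : enorm (x - y) = enorm (y - x).
Proof. by rewrite -opprB enormN. Qed.

Lemma dot_le_enorm x y : \sum_(i < n) x 0 i * y 0 i <= enorm x * enorm y.
Proof.
set D := \sum_(i < n) _.
have key : D ^+ 2 <= enorm x ^+ 2 * enorm y ^+ 2.
  (* The vector |y|^2 x - D y is |y|^2 times the part of x orthogonal to y. *)
  have : 0 <= \sum_(i < n) (enorm y ^+ 2 * x 0 i - D * y 0 i) ^+ 2.
    by rewrite sumr_ge0// => i _; rewrite sqr_ge0.
  have -> : \sum_(i < n) (enorm y ^+ 2 * x 0 i - D * y 0 i) ^+ 2 =
      enorm y ^+ 2 * (enorm x ^+ 2 * enorm y ^+ 2 - D ^+ 2).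
    rewrite (eq_bigr (fun i => (enorm y ^+ 2) ^+ 2 * (x 0 i ^+ 2) +
      (- (2 * enorm y ^+ 2 * D)) * (x 0 i * y 0 i) + D ^+ 2 * (y 0 i ^+ 2))).
      by rewrite !big_split/= -!mulr_sumr -!enorm_sqr -/D; ring.
    by move=> i _; ring.
  have [y0|y0] := eqVneq (enorm y) 0.
    have -> : D = 0.
      by rewrite /D big1// => i _; rewrite (enorm_eq0 y0) mxE mulr0.
    by rewrite y0 !expr0n/= mulr0.
  by rewrite pmulr_rge0 ?subr_ge0// exprn_gt0// lt_def y0 enorm_ge0.
rewrite -exprMn in key.
have := enorm_ge0 x; have := enorm_ge0 y => y0 x0.
have [D0|D0] := leP D 0; first by rewrite (le_trans D0)// mulr_ge0.
by rewrite -(@ler_pXn2r _ 2)// nnegrE ?mulr_ge0// ltW.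
Qed.

Lemma enormD_sqr x y :
  enorm (x + y) ^+ 2 =
  enorm x ^+ 2 + 2 * (\sum_(i < n) x 0 i * y 0 i) + enorm y ^+ 2.
Proof.
rewrite !enorm_sqr mulr_sumr -!big_split/=.
by apply: eq_bigr => i _; rewrite mxE; ring.
Qed.

Lemma ler_enormD x y : enorm (x + y) <= enorm x + enorm y.
Proof.
rewrite -(@ler_pXn2r _ 2)// ?nnegrE ?addr_ge0 ?enorm_ge0// enormD_sqr.
by have := dot_le_enorm x y; lra.
Qed.

Lemma enorm_triangle y x z : enorm (x - z) <= enorm (x - y) + enorm (y - z).
Proof. by rewrite (le_trans _ (ler_enormD _ _))// addrA subrK. Qed.

Lemma enorm_triangle0 x y : enorm x <= enorm (x - y) + enorm y.
Proof. by have := enorm_triangle y x 0; rewrite !subr0. Qed.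

Lemma coord_le_enorm x i : `|x 0 i| <= enorm x.
Proof.
rewrite -(@ler_pXn2r _ 2)// ?nnegrE ?enorm_ge0//.
rewrite enorm_sqr real_normK ?num_real//.
by rewrite (bigD1 i)//= lerDl sumr_ge0// => j _; exact: sqr_ge0.
Qed.

Lemma mxnorm_le_enorm x : `|x| <= enorm x.
Proof.
rewrite [leLHS]/Num.norm/= mx_normrE; apply/bigmax_leP; split=> [|[i j] _ /=].
  exact: enorm_ge0.
by rewrite ord1 coord_le_enorm.
Qed.

Lemma continuous_sqd y :
  continuous (fun x : 'rV[R]_n => \sum_(i < n) (x 0 i - y 0 i) ^+ 2).
Proof.
have cont i : continuous (fun x : 'rV[R]_n => (x 0 i - y 0 i) ^+ 2).
  move=> x; apply: (@continuous_comp _ _ _ (fun x : 'rV[R]_n => x 0 i - y 0 i)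
    (fun t : R => t ^+ 2)); last exact: exprn_continuous.
  apply: continuousB; last exact: cst_continuous.
  exact: (@coord_continuous R 1 n 0 i x).
by have := @continuous_big R 'I_n +%R 0 xpredT (@add_continuous R) _ (index_enum _)
  _ (fun i _ => cont i).
Qed.

Lemma enormB_sqr x y : enorm (x - y) ^+ 2 = \sum_(i < n) (x 0 i - y 0 i) ^+ 2.
Proof. by rewrite enorm_sqr; apply: eq_bigr => i _; rewrite !mxE. Qed.

Lemma enorm_dist_continuous y : continuous (fun x : 'rV[R]_n => enorm (x - y)).
Proof.
move=> x; rewrite /enorm.
have -> : (fun z : 'rV[R]_n => Num.sqrt (\sum_(i < n) (z - y) 0 i ^+ 2)) =
  Num.sqrt \o (fun z => \sum_(i < n) (z 0 i - y 0 i) ^+ 2).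
  by apply/funext => z /=; congr Num.sqrt; apply: eq_bigr => i _; rewrite !mxE.
by apply: continuous_comp; [exact: continuous_sqd|exact: sqrt_continuous].
Qed.

(** Passes from the sup-norm topology to Euclidean balls: [|x| <= enorm x] gives one direction and
    continuity of [enorm] the other, without a constant depending on the dimension. *)
Lemma nbhs_enormP x (P : set 'rV[R]_n) :
  nbhs x P <-> exists2 d, 0 < d & forall z, enorm (z - x) < d -> P z.
Proof.
split=> [/nbhs_ballP[d/= d0 dP]|[d d0 dP]].
  exists d => // z zx; apply: dP; rewrite -ball_normE/= distrC.
  exact: le_lt_trans (mxnorm_le_enorm _) zx.
have := @enorm_dist_continuous x x.
move=> /cvgrPdist_lt/(_ _ d0); apply: filterS => z/=.
by rewrite subrr enorm0 sub0r normrN ger0_norm ?enorm_ge0//; exact: dP.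
Qed.

End EuclideanNorm.

Lemma compact_annulus (R : realType) n (y : 'rV[R]_n) (a b : R) :
  compact [set x | a <= enorm (x - y) <= b].
Proof.
apply: bounded_closed_compact.
  exists (`|y| + b); split; first exact: num_real.
  move=> t bt x/= /andP[_ xb]; apply: le_trans (ltW bt).
  rewrite -[x](subrK y) (le_trans (ler_normD _ _))// addrC lerD2l.
  exact: le_trans (mxnorm_le_enorm _) xb.
have -> : [set x | a <= enorm (x - y) <= b] =
    (fun x => enorm (x - y)) @^-1` `[a, b]%classic.
  by apply/seteqP; split=> x/=; rewrite in_itv.
by apply: closed_comp; [move=> x _; exact: enorm_dist_continuous|exact: itv_closed].
Qed.

Definition lsc_in (R : realType) n (A : set 'rV[R]_n) (f : 'rV[R]_n -> R) :=
  forall x a, A x -> a < f x ->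
    exists2 d, 0 < d & forall z, A z -> enorm (z - x) < d -> a < f z.

(** The sublevel sets at points of A generate a proper filter. A cluster point p is a minimiser,
    because f z < f p would make f exceed f z near p, off the sublevel set of z. *)
Lemma lsc_in_min (R : realType) n (A : set 'rV[R]_n) (f : 'rV[R]_n -> R) :
  compact A -> A !=set0 -> lsc_in A f ->
  exists2 x, A x & forall z, A z -> f x <= f z.
Proof.
move=> cA [x0 Ax0] lscf.
pose B x := [set z | A z /\ f z <= f x].
pose F := filter_from A B.
have FF : ProperFilter F.
  apply: filter_from_proper; last by move=> x Ax; exists x; split.
  apply: filter_from_filter; first by exists x0.
  move=> x y Ax Ay; have [xy|yx] := leP (f x) (f y).
    by exists x => // z [Az zx]; split; split=> //; exact: le_trans zx xy.
  by exists y => // z [Az zy]; split; split=> //; exact: le_trans zy (ltW yx).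
have [|p [Ap clp]] := cA F FF; first by exists x0 => // z [].
exists p => // z Az; rewrite leNgt; apply/negP => zp.
have [d d0 dP] := lscf _ _ Ap zp.
have Bz : F (B z) by exists z.
have nd : nbhs p [set w | enorm (w - p) < d] by apply/nbhs_enormP; exists d.
have [w [[Aw wz] wp]] := clp _ _ Bz nd.
by have := dP _ Aw wp; rewrite ltNge wz.
Qed.

(** * Spectra of rank-one perturbations and the cone *)

Section RankOnePerturbation.
Variable F : fieldType.

(** The determinant of the bordered matrix [M] is computed through each of its two Schur
    complements. The entries lie in a domain because the lemma serves c = X - a in a polynomial
    ring, where the common factor c is cancelled. *)
Lemma det_scalar_sub_rank1 (D : idomainType) n (c : D) (p : 'cV[D]_n.+1)
    (q : 'rV[D]_n.+1) : c != 0 ->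
  \det (c%:M - p *m q) = c ^+ n * (c - (q *m p) 0 0).
Proof.
move=> c0; pose M := block_mx 1%:M q p c%:M : 'M[D]_(1 + n.+1).
have M1 : \det M = \det (c%:M - p *m q).
  have -> : M = block_mx 1%:M 0 p 1%:M *m block_mx 1%:M q 0 (c%:M - p *m q).
    rewrite mulmx_block !mul0mx !mulmx0 !mul1mx !mulmx1 !addr0.
    by rewrite addrC subrK.
  by rewrite det_mulmx det_lblock det_ublock !det1 !mul1r.
have M2 : \det M * c = (c - (q *m p) 0 0) * c ^+ n.+1.
  have N1 : \det (block_mx c%:M 0 (- p) 1%:M : 'M[D]_(1 + n.+1)) = c.
    by rewrite det_lblock det1 mulr1 det_scalar1.
  rewrite -[X in _ * X]N1 -det_mulmx mulmx_block !mulmx0 !mul1mx !mulmx1 !add0r.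
  have -> : p *m c%:M + c%:M *m - p = 0.
    by rewrite mul_scalar_mx mul_mx_scalar scalerN subrr.
  rewrite det_ublock det_scalar det_mx11 mulmxN !mxE eqxx mulr1n.
  by [].
by apply: (mulIf c0); rewrite -M1 M2 exprS; ring.
Qed.

Lemma char_poly_scalar_rank1 n (a g : F) (d : 'rV[F]_n.+1) :
  char_poly (a%:M + g *: (d^T *m d)) =
  ('X - a%:P) ^+ n * ('X - (a + g * \sum_(i < n.+1) d 0 i ^+ 2)%:P).
Proof.
rewrite /char_poly /char_poly_mx.
have -> : 'X%:M - map_mx polyC (a%:M + g *: (d^T *m d)) =
    ('X - a%:P)%:M - (map_mx polyC (g *: d^T)) *m map_mx polyC d.
  apply/matrixP => i j; rewrite !mxE !big_ord1 !mxE rmorphD/= rmorphMn/=.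
  by rewrite mulrnBl opprD addrA !rmorphM/= mulrA.
rewrite det_scalar_sub_rank1 ?polyXsubC_eq0//; congr (_ * _).
rewrite polyCD opprD addrA; congr (_ - _); rewrite mxE rmorphM rmorph_sum/=.
by rewrite mulr_sumr; apply: eq_bigr => i _; rewrite !mxE/= rmorphM rmorphXn/=; ring.
Qed.

(** Unique factorization of the characteristic polynomial identifies the listed eigenvalues up to
    order; the permutation puts the exceptional one at index 0, the shape of [head_tail]. *)
Lemma rank1_eigenvalues_perm n (a g : F) (d l : 'rV[F]_n.+1) :
  char_poly (a%:M + g *: (d^T *m d)) = \prod_(i < n.+1) ('X - (l 0 i)%:P) ->
  exists s : 'S_n.+1, forall i, l 0 (s i) =
    if (i : nat) == 0%N then a + g * \sum_(i < n.+1) d 0 i ^+ 2 else a.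
Proof.
rewrite char_poly_scalar_rank1; set b := a + _ => E.
pose t := [tuple (if (i : nat) == 0%N then b else a) | i < n.+1].
pose r := [tuple l 0 i | i < n.+1].
have : perm_eq t r.
  apply: prod_XsubC_eq.
  rewrite !big_tuple [RHS](eq_bigr (fun i => 'X - (l 0 i)%:P)); last first.
    by move=> i _; rewrite tnth_mktuple.
  rewrite -E big_ord_recl tnth_mktuple/= mulrC; congr (_ * _).
  rewrite (eq_bigr (fun=> 'X - a%:P)); first by rewrite prodr_const card_ord.
  by move=> i _; rewrite tnth_mktuple.
move=> /tuple_permP[s ts]; exists s => i.
have := congr1 (fun u : n.+1.-tuple F => tnth u i) (val_inj ts).
by rewrite !tnth_mktuple => <-.
Qed.

Lemma char_poly_prod_trace n (A : 'M[F]_n.+1) (l : 'rV[F]_n.+1) :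
  char_poly A = \prod_(i < n.+1) ('X - (l 0 i)%:P) ->
  \tr A = \sum_(i < n.+1) l 0 i.
Proof.
move=> E; apply/eqP; rewrite -eqr_opp -char_poly_trace// E.
pose r := [tuple l 0 i | i < n.+1].
have -> : \prod_(i < n.+1) ('X - (l 0 i)%:P) = \prod_(x <- r) ('X - x%:P).
  by rewrite big_tuple; apply: eq_bigr => i _; rewrite tnth_mktuple.
have := @coefPn_prod_XsubC _ r; rewrite size_tuple => -> //.
by rewrite big_tuple; apply/eqP; congr (- _); apply: eq_bigr => i _; rewrite tnth_mktuple.
Qed.

End RankOnePerturbation.

(** * Constraints that the two boundary points put on the closed cone *)

Section ConeFacts.
Variables (R : realType) (n : nat) (G : set 'rV[R]_n.+1) (mu : R).
Hypotheses (G_open : open G)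
  (G_convex : convex_set (G : set (convex_lmodType 'rV[R]_n.+1)))
  (G_symmetric : symmetric_set G) (G_cone : is_cone G)
  (G_pos : [set l : 'rV[R]_n.+1 | forall i, 0 < l 0 i] `<=` G)
  (G_trace : G `<=` [set l : 'rV[R]_n.+1 | 0 < \sum_(i < n.+1) l 0 i])
  (G_axis : boundary G (head_tail n.+1 1 0))
  (mu_ge0 : 0 <= mu) (mu_plus : boundary G (head_tail n.+1 (- mu) 1)).

Lemma cone_add x y : G x -> G y -> G (x + y).
Proof.
move=> Gx Gy.
have h0 : 0 <= 2^-1 :> R by lra.
have h1 : 2^-1 <= 1 :> R by lra.
have := @G_convex x y (Itv01 h0 h1).
rewrite !inE => /(_ Gx Gy) h.
have : G (2 *: (2^-1 *: x + 2^-1 *: y)).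
  apply: G_cone => //.
  move: h; rewrite /conv/= /unstable.onem.
  by have -> : 1 - 2^-1 = 2^-1 :> R by lra.
by rewrite scalerDr !scalerA divff// !scale1r.
Qed.

(** The pushed point differs from a nearby point of G by a vector with positive entries, so the
    diagonal direction leads from the closed cone into the open one. *)
Lemma closure_cone_add_const x (e : R) :
  closure G x -> 0 < e -> G (x + const_mx e).
Proof.
move=> Gx e0.
have [z [Gz zx]] : G `&` [set z | enorm (z - x) < e] !=set0.
  by apply: Gx; apply/nbhs_enormP; exists e.
have -> : x + const_mx e = z + (x + const_mx e - z) by rewrite [RHS]addrC subrK.
apply: cone_add => //; apply: G_pos => i; rewrite !mxE.
have := le_lt_trans (coord_le_enorm (z - x) i) zx.
by rewrite !mxE ltr_norml => /andP[]; lra.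
Qed.

Lemma closure_cone_trace x : closure G x -> 0 <= \sum_(i < n.+1) x 0 i.
Proof.
move=> Gx; rewrite leNgt; apply/negP => x0.
have e0 : 0 < - (\sum_(i < n.+1) x 0 i) / n.+1%:R.
  by rewrite divr_gt0// oppr_gt0.
have /G_trace/= := closure_cone_add_const Gx e0.
under eq_bigr do rewrite !mxE.
by rewrite big_split/= sumr_const card_ord -[X in _ + X]mulr_natr divfK ?pnatr_eq0// subrr ltxx.
Qed.

Lemma boundary_notin x : boundary G x -> ~ G x.
Proof. by move=> [_]; have /interior_id -> := G_open. Qed.

Lemma head_tail_scale (t c d : R) :
  t *: head_tail n.+1 c d = head_tail n.+1 (t * c) (t * d).
Proof. by apply/rowP => i; rewrite !mxE; case: ifP. Qed.

Lemma sum_head_tail (c d : R) :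
  \sum_(i < n.+1) head_tail n.+1 c d 0 i = c + d * n%:R.
Proof.
rewrite big_ord_recl !mxE/=; congr (_ + _).
by under eq_bigr do rewrite mxE/=; rewrite sumr_const card_ord mulr_natr.
Qed.

(** If one of the inequalities failed, a suitable push e along the diagonal would land on the ray of
    a boundary point: e = -b gives a positive multiple of (1,0,...,0), the other choice one of
    (-mu,1,...,1). An open cone contains neither. *)
Lemma head_tail_constraints (l : 'rV[R]_n.+1) (s : 'S_n.+1) (a b : R) :
  closure G l -> (forall i, l 0 (s i) = if (i : nat) == 0%N then a else b) ->
  0 <= b /\ 0 <= a + mu * b.
Proof.
move=> Gl lE.
have Gab e : 0 < e -> G (head_tail n.+1 (a + e) (b + e)).
  move=> e0; have /(G_symmetric s) := closure_cone_add_const Gl e0.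
  congr (G _); apply/rowP => i; rewrite !mxE lE.
  by case: ifP.
have b0 : 0 <= b.
  rewrite leNgt; apply/negP => b0.
  have nb0 : 0 < - b by rewrite oppr_gt0.
  have := Gab _ nb0; rewrite subrr => Ga.
  have ab : 0 < a - b by have := G_trace Ga; rewrite /= sum_head_tail mul0r addr0.
  apply: (boundary_notin G_axis).
  have iab : 0 < (a - b)^-1 by rewrite invr_gt0.
  have := G_cone iab Ga.
  by rewrite head_tail_scale mulr0 mulVf// gt_eqF.
split=> //; rewrite leNgt; apply/negP => ab.
have m1 : 0 < 1 + mu by rewrite (lt_le_trans ltr01)// lerDl.
(* Solves a + e = -mu (b + e). *)
pose e := (- mu * b - a) / (1 + mu).
have e0 : 0 < e by rewrite divr_gt0//; lra.
apply: (boundary_notin mu_plus).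
have be : 0 < b + e by rewrite ltr_wpDl.
have ibe : 0 < (b + e)^-1 by rewrite invr_gt0.
have := G_cone ibe (Gab _ e0); rewrite head_tail_scale mulVf ?gt_eqF//.
suff -> : (b + e)^-1 * (a + e) = - mu by [].
have -> : a + e = - mu * (b + e) by rewrite /e; field; rewrite gt_eqF.
by rewrite mulrC -mulrA divff ?gt_eqF// mulr1.
Qed.

End ConeFacts.

(** * Test functions *)

Section PointfulDerivatives.
Variables (R : realType) (V : normedModType R).
Implicit Types (f g : V -> R).

Lemma is_derive_add f g (x v : V) (a b : R) : is_derive x v f a ->
  is_derive x v g b -> is_derive x v (fun z => f z + g z) (a + b).
Proof. by move=> fa gb; exact: is_deriveD. Qed.

Lemma is_derive_mul f g (x v : V) (a b : R) : is_derive x v f a ->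
  is_derive x v g b -> is_derive x v (fun z => f z * g z) (f x * b + g x * a).
Proof. by move=> fa gb; exact: is_deriveM. Qed.

Lemma is_derive_const (x v : V) (c : R) : is_derive x v (fun=> c) 0.
Proof. exact: is_derive_cst. Qed.

Lemma is_derive_sub_const f (x v : V) (a c : R) :
  is_derive x v f a -> is_derive x v (fun z => f z - c) a.
Proof.
by move=> fa; have := is_derive_add fa (is_derive_const x v (- c)); rewrite addr0.
Qed.

Lemma is_derive_scale f (x v : V) (a c : R) :
  is_derive x v f a -> is_derive x v (fun z => c * f z) (c * a).
Proof.
move=> fa; have := is_derive_mul (is_derive_const x v c) fa.
by rewrite mulr0 addr0.
Qed.

Lemma is_derive_sum_fun n (h : 'I_n -> V -> R) (x v : V) (dh : 'I_n -> R) :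
  (forall i, is_derive x v (h i) (dh i)) ->
  is_derive x v (fun z => \sum_(i < n) h i z) (\sum_(i < n) dh i).
Proof.
move=> hd; have := is_derive_sum hd.
suff -> : \sum_(i < n) h i = (fun z => \sum_(i < n) h i z) by [].
by apply/funext => z; rewrite fct_sumE.
Qed.

End PointfulDerivatives.

Section PointfulContinuity.
Variables (R : realType) (T : topologicalType).
Implicit Types (f g : T -> R).

Lemma continuous_at_mul f g x : continuous_at x f -> continuous_at x g ->
  continuous_at x (fun z => f z * g z).
Proof. by move=> cf cg; exact: cvgM. Qed.

Lemma continuous_at_add f g x : continuous_at x f -> continuous_at x g ->
  continuous_at x (fun z => f z + g z).
Proof. by move=> cf cg; exact: cvgD. Qed.

Lemma continuous_at_sub f g x : continuous_at x f -> continuous_at x g ->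
  continuous_at x (fun z => f z - g z).
Proof. by move=> cf cg; exact: cvgB. Qed.

End PointfulContinuity.

Section QuadraticTest.
Variables (R : realType) (n : nat).
Implicit Types x y : 'rV[R]_n.

Definition sqd y x : R := \sum_(i < n) (x 0 i - y 0 i) ^+ 2.

Lemma sqd_ge0 y x : 0 <= sqd y x.
Proof. by rewrite sumr_ge0// => i _; rewrite sqr_ge0. Qed.

Lemma sqdE y x : sqd y x = enorm (x - y) ^+ 2.
Proof. by rewrite enormB_sqr. Qed.

(** A quadratic polynomial in |x - y|^2 - s, hence C^2 everywhere, the centre y included, and zero
    where |x - y|^2 = s. [quad1] and [quad2] are its first and second partial derivatives. *)
Definition quad y (c1 c2 s : R) x :=
  c1 * (sqd y x - s) + c2 * ((sqd y x - s) * (sqd y x - s)).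

Definition quad1 y (c1 c2 s : R) (i : 'I_n) x :=
  2 * (x 0 i - y 0 i) * (c1 + 2 * c2 * (sqd y x - s)).

Definition quad2 y (c1 c2 s : R) (i j : 'I_n) x :=
  2 * (i == j)%:R * (c1 + 2 * c2 * (sqd y x - s)) +
  8 * c2 * ((x 0 i - y 0 i) * (x 0 j - y 0 j)).

Lemma is_derive_coord x (v : 'rV[R]_n) j :
  is_derive x v (fun z : 'rV[R]_n => z 0 j) (v 0 j).
Proof.
have d : derivable (@id 'rV[R]_n) x v by exact: derivable_id.
apply: DeriveDef; first by have /derivable_mxP := d; exact.
by have /matrixP/(_ 0 j) := derive_mx d; rewrite derive_id mxE.
Qed.

Lemma is_derive_coord_sub x y i j :
  is_derive x (delta_mx 0 i) (fun z : 'rV[R]_n => z 0 j - y 0 j) ((i == j)%:R).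
Proof.
apply: is_derive_sub_const; have := is_derive_coord x (delta_mx 0 i) j.
by rewrite mxE eqxx/= eq_sym.
Qed.

Lemma is_derive_sqd y x i :
  is_derive x (delta_mx 0 i) (sqd y) (2 * (x 0 i - y 0 i)).
Proof.
have -> : sqd y = (fun z => \sum_(j < n) (z 0 j - y 0 j) * (z 0 j - y 0 j)).
  by apply/funext => z; apply: eq_bigr => j _; rewrite expr2.
have -> : 2 * (x 0 i - y 0 i) = \sum_(j < n)
    ((x 0 j - y 0 j) * (i == j)%:R + (x 0 j - y 0 j) * (i == j)%:R).
  rewrite (bigD1 i)//= big1 ?addr0 ?eqxx ?mulr1; first by ring.
  by move=> j ji; rewrite eq_sym (negbTE ji) mulr0 addr0.
apply: is_derive_sum_fun => j.
by apply: is_derive_mul; exact: is_derive_coord_sub.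
Qed.

Lemma is_derive_quad y c1 c2 s x i :
  is_derive x (delta_mx 0 i) (quad y c1 c2 s) (quad1 y c1 c2 s i x).
Proof.
have D := is_derive_sub_const s (is_derive_sqd y x i).
apply: is_derive_eq (is_derive_add (is_derive_scale c1 D)
  (is_derive_scale c2 (is_derive_mul D D))) _.
by rewrite /quad1; ring.
Qed.

Lemma is_derive_quad1 y c1 c2 s x i j :
  is_derive x (delta_mx 0 i) (quad1 y c1 c2 s j) (quad2 y c1 c2 s i j x).
Proof.
have D := is_derive_sub_const s (is_derive_sqd y x i).
have E := is_derive_coord_sub x y i j.
apply: is_derive_eq (is_derive_mul (is_derive_scale 2 E)
  (is_derive_add (is_derive_const _ _ c1) (is_derive_scale (2 * c2) D))) _.
by rewrite /quad2; ring.
Qed.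

Lemma continuous_coord_sub y i :
  continuous (fun z : 'rV[R]_n => z 0 i - y 0 i).
Proof.
move=> x; apply: continuousB; last exact: cst_continuous.
exact: (@coord_continuous R 1 n 0 i x).
Qed.

Lemma continuous_quad1 y c1 c2 s i : continuous (quad1 y c1 c2 s i).
Proof.
move=> x; apply: continuous_at_mul; first apply: continuous_at_mul.
- exact: cst_continuous.
- exact: continuous_coord_sub.
apply: continuous_at_add; first exact: cst_continuous.
apply: continuous_at_mul; first exact: cst_continuous.
by apply: continuous_at_sub; [exact: continuous_sqd|exact: cst_continuous].
Qed.

Lemma continuous_quad2 y c1 c2 s i j : continuous (quad2 y c1 c2 s i j).
Proof.
move=> x; apply: continuous_at_add; apply: continuous_at_mul.
- exact: cst_continuous.
- apply: continuous_at_add; first exact: cst_continuous.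
  apply: continuous_at_mul; first exact: cst_continuous.
  by apply: continuous_at_sub; [exact: continuous_sqd|exact: cst_continuous].
- exact: cst_continuous.
- by apply: continuous_at_mul; exact: continuous_coord_sub.
Qed.

Variables (y z : 'rV[R]_n) (c0 c1 c2 s d1 d2 t : R).

(** Two centres, because the Hopf barrier adds a radial function around an interior point to the
    fundamental solution around the origin. The purely radial case has zero coefficients in the
    second slot. *)
Definition test_fun x := c0 + (quad y c1 c2 s x + quad z d1 d2 t x).

Lemma partial_test_fun i :
  partial i test_fun = fun x => quad1 y c1 c2 s i x + quad1 z d1 d2 t i x.
Proof.
apply/funext => x.
have D := is_derive_add (is_derive_const x (delta_mx 0 i) c0)
  (is_derive_add (is_derive_quad y c1 c2 s x i) (is_derive_quad z d1 d2 t x i)).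
by rewrite /partial (@derive_val _ _ _ _ _ _ _ D) add0r.
Qed.

Lemma partial2_test_fun i j :
  partial i (partial j test_fun) =
  fun x => quad2 y c1 c2 s i j x + quad2 z d1 d2 t i j x.
Proof.
apply/funext => x; rewrite partial_test_fun.
have D := is_derive_add (is_derive_quad1 y c1 c2 s x i j)
  (is_derive_quad1 z d1 d2 t x i j).
by rewrite /partial (@derive_val _ _ _ _ _ _ _ D).
Qed.

Lemma test_fun_C2 (O : set 'rV[R]_n) : C2_on O test_fun.
Proof.
split=> [i x _|j i x _].
  split.
    apply: ex_derive.
    exact: (is_derive_add (is_derive_const x (delta_mx 0 i) c0)
      (is_derive_add (is_derive_quad y c1 c2 s x i) (is_derive_quad z d1 d2 t x i))).
  rewrite partial_test_fun.
  by apply: continuous_at_add; exact: continuous_quad1.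
rewrite partial2_test_fun; split.
  rewrite partial_test_fun; apply: ex_derive.
  exact: (is_derive_add (is_derive_quad1 y c1 c2 s x i j)
    (is_derive_quad1 z d1 d2 t x i j)).
by apply: continuous_at_add; exact: continuous_quad2.
Qed.

End QuadraticTest.

(** [F1] need be differentiable only at s. Its difference quotient, with the loss d absorbing the
    error, makes the derivative of F minus the parabola have the sign of t - s near s; by the mean
    value theorem this difference is minimal at s. *)
Lemma taylor2_lower (R : realType) (F F1 : R -> R) (s F2 d : R) :
  (\forall t \near s, is_derive (t : R) (1 : R) F (F1 t)) -> is_derive s 1 F1 F2 -> 0 < d ->
  \forall t \near s,
    F s + F1 s * (t - s) + (F2 - d) / 2 * ((t - s) * (t - s)) <= F t.
Proof.
move=> FF1 F1F2 d0.
have : \forall h \near 0, (F2 - d) * (h * h) <= h * (F1 (h + s) - F1 s).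
  have [dF1 eF1] := F1F2.
  have : h^-1 *: (F1 (h *: (1 : R) + s) - F1 s) @[h --> 0^'] --> F2.
    by rewrite -eF1; exact: dF1.
  move=> /cvgrPdist_lt/(_ _ d0); rewrite near_withinE; apply: filterS => h.
  have [->|h0] := eqVneq h 0; first by rewrite !mul0r mulr0.
  move=> /(_ isT); rewrite ltr_distlC => /andP[+ _] => /ltW H.
  rewrite [h%:A]mulr1 in H.
  have := ler_wpM2r (sqr_ge0 h) H; rewrite expr2 => /le_trans; apply.
  by rewrite /GRing.scale/= mulrAC mulrA mulVf// mul1r.
move=> /nbhs_ballP[e1/= e10 E1].
move: FF1 => /nbhs_ballP[e2/= e20 E2].
pose e := Num.min e1 e2; have e0 : 0 < e by rewrite lt_min e10.
pose k t := F t + (- F1 s) * (t - s) + - ((F2 - d) / 2) * ((t - s) * (t - s)).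
pose k1 t := F1 t - F1 s - (F2 - d) * (t - s).
have kd t : `|t - s| < e -> is_derive t 1 k (k1 t).
  move=> ts; have Ft : is_derive t 1 F (F1 t).
    by apply: E2; rewrite -ball_normE/= distrC (lt_le_trans ts)// ge_min lexx orbT.
  have D := is_derive_sub_const s (is_derive_id t (1 : R)).
  apply: is_derive_eq (is_derive_add (is_derive_add Ft (is_derive_scale _ D))
    (is_derive_scale _ (is_derive_mul D D))) _.
  by rewrite /k1; field.
have k1s t : `|t - s| < e -> 0 <= (t - s) * k1 t.
  move=> ts; have := E1 (t - s).
  rewrite -ball_normE/= sub0r normrN subrK => h.
  have := h (lt_le_trans ts _); rewrite ge_min lexx => /(_ isT).
  by rewrite /k1; lra.
have kmvt a b : a < b -> (forall t, a <= t <= b -> `|t - s| < e) ->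
    exists2 c, a < c < b & k b - k a = k1 c * (b - a).
  move=> ab abe; have [|||c] := @MVT _ k k1 a b.
  - exact: ab.
  - move=> x /[!in_itv]/= /andP[ax xb]; apply: kd; apply: abe; lra.
  - apply: derivable_within_continuous => x /[!in_itv]/= axb.
    by apply: ex_derive; apply: kd; exact: abe.
  by rewrite in_itv/= => cab Ec; exists c.
have kle t : `|t - s| < e -> k s <= k t.
  rewrite ltr_norml => /andP[et te].
  have in_e c : t <= c <= s \/ s <= c <= t -> `|c - s| < e.
    by rewrite ltr_norml; case; lra.
  case: (ltgtP t s) => [lts|lts|-> //].
  - have [c /andP[tc cs] Ec] := kmvt t s lts (fun c h => in_e c (or_introl h)).
    have : 0 <= (c - s) * k1 c by apply: k1s; apply: in_e; left; lra.
    rewrite nmulr_rge0 ?subr_lt0// => k1c.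
    by rewrite -subr_le0 Ec mulr_le0_ge0// subr_ge0 ltW.
  - have [c /andP[sc ct] Ec] := kmvt s t lts (fun c h => in_e c (or_intror h)).
    have : 0 <= (c - s) * k1 c by apply: k1s; apply: in_e; right; lra.
    rewrite pmulr_rge0 ?subr_gt0// => k1c.
    by rewrite -subr_ge0 Ec mulr_ge0// subr_ge0 ltW.
apply/nbhs_ballP; exists e => //= t.
rewrite -ball_normE/= distrC => /kle; rewrite /k subrr !mulr0 !addr0; lra.
Qed.

(** * Eigenvalue inequalities at a touching point *)

Section Touching.
Variables (R : realType) (n : nat) (G : set 'rV[R]_n.+1) (mu : R).
Hypotheses (n_ge3 : (3 <= n.+1)%N) (G_open : open G)
  (G_convex : convex_set (G : set (convex_lmodType 'rV[R]_n.+1)))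
  (G_symmetric : symmetric_set G) (G_cone : is_cone G)
  (G_pos : [set l : 'rV[R]_n.+1 | forall i, 0 < l 0 i] `<=` G)
  (G_trace : G `<=` [set l : 'rV[R]_n.+1 | 0 < \sum_(i < n.+1) l 0 i])
  (G_axis : boundary G (head_tail n.+1 1 0))
  (mu_ge0 : 0 <= mu) (mu_plus : boundary G (head_tail n.+1 (- mu) 1)).
Variables (O : set 'rV[R]_n.+1) (u : 'rV[R]_n.+1 -> R).
Hypothesis visc : viscosity_in G O u.

Let m : R := n.+1%:R.

Let m2_gt0 : 0 < m - 2.
Proof. by rewrite subr_gt0 /m ltr_nat. Qed.

(* [field] normalizes [n.+1%:R - 2] to this shape. *)
Let m2_neq0 : 1 + n%:R - 2 != 0 :> R.
Proof. by rewrite [1 + _]addrC natr1 gt_eqF. Qed.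

Lemma test_fun_center (y z : 'rV[R]_n.+1) c0 c1 c2 d1 d2 x :
  test_fun y z c0 c1 c2 (sqd y x) d1 d2 (sqd z x) x = c0.
Proof. by rewrite /test_fun /quad !subrr !mulr0 !addr0. Qed.

Lemma test_fun_touch (y z : 'rV[R]_n.+1) c1 c2 d1 d2 x : O x ->
  (\forall w \near x,
     test_fun y z (u x) c1 c2 (sqd y x) d1 d2 (sqd z x) w <= u w) ->
  eigenvalues_in
    (conformal_mx (test_fun y z (u x) c1 c2 (sqd y x) d1 d2 (sqd z x)) x)
    (closure G).
Proof.
move=> Ox le_u; apply: visc => //; first exact: test_fun_C2.
  by rewrite test_fun_center subrr.
by apply: filterS le_u => w; rewrite subr_ge0.
Qed.

(** The two exponents in the conformal matrix differ by one, so a single power of the solution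
    factors out of all entries. *)
Lemma conformal_powR (p : R) : 0 < p ->
  p `^ (- ((m + 2) / (m - 2))) = p * p `^ (- (2 * m / (m - 2))).
Proof.
move=> p0; rewrite -{2}(powRr1 (ltW p0)) -powRD; last by rewrite (gt_eqF p0)/= implybT.
by congr (p `^ _); field; exact: m2_neq0.
Qed.

(** The eigenvalues are [a], on the orthogonal complement of x - y, and a + g |x - y|^2 along x - y.
    The conclusions are the two cone inequalities with the positive factor [k] removed. *)
Lemma radial_touch_quad (y : 'rV[R]_n.+1) c1 c2 x : O x -> 0 < u x ->
  (\forall w \near x, u x + quad y c1 c2 (sqd y x) w <= u w) ->
  c1 * (u x + 2 * sqd y x * c1 / (m - 2)) <= 0 /\
  0 <= - (1 + mu) * 4 * c1 / (m - 2) * (u x + 2 * sqd y x * c1 / (m - 2)) +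
    sqd y x * (- 16 * c2 * u x / (m - 2) + 8 * m * c1 ^+ 2 / (m - 2) ^+ 2).
Proof.
move=> Ox ux le_u.
have [|l [El Gl]] := @test_fun_touch y y c1 c2 0 0 x Ox.
  apply: filterS le_u => w; rewrite /test_fun; apply: le_trans.
  by rewrite /quad !mul0r !addr0.
move: El; set s := sqd y x.
pose k := u x `^ (- (2 * m / (m - 2))).
have k0 : 0 < k by rewrite powR_gt0.
pose a := k * (- 4 * c1 / (m - 2) * (u x + 2 * s * c1 / (m - 2))).
pose g := k * (- 16 * c2 * u x / (m - 2) + 8 * m * c1 ^+ 2 / (m - 2) ^+ 2).
pose d : 'rV[R]_n.+1 := x - y.
have sE : s = \sum_(i < n.+1) d 0 i ^+ 2.
  by apply: eq_bigr => i _; rewrite !mxE.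
have gE : enorm (gradient (test_fun y y (u x) c1 c2 s 0 0 s) x) ^+ 2 = 4 * c1 ^+ 2 * s.
  rewrite enorm_sqr [in RHS]sE mulr_sumr; apply: eq_bigr => i _.
  rewrite !mxE partial_test_fun /quad1 -/s subrr; ring.
have -> : conformal_mx (test_fun y y (u x) c1 c2 s 0 0 s) x =
    a%:M + g *: (d^T *m d).
  apply/matrixP => i j; rewrite /conformal_mx -/m !mxE big_ord1 !mxE.
  rewrite gE test_fun_center conformal_powR// -/k.
  rewrite partial2_test_fun !partial_test_fun /quad1 /quad2 -/s subrr.
  rewrite -[a *+ _]mulr_natr /a /g.
  by field; exact: m2_neq0.
move=> /rank1_eigenvalues_perm[p lE].
have [a0 ag0] := head_tail_constraints G_open G_convex G_symmetric G_cone G_pos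
  G_trace G_axis mu_ge0 mu_plus Gl lE.
rewrite -sE in ag0.
split.
  move: a0; rewrite /a pmulr_rge0//.
  have -> : - 4 * c1 / (m - 2) * (u x + 2 * s * c1 / (m - 2)) =
    - (4 / (m - 2) * (c1 * (u x + 2 * s * c1 / (m - 2)))).
    by field; exact: m2_neq0.
  by rewrite oppr_ge0 pmulr_rle0// divr_gt0.
rewrite -(pmulr_rge0 _ k0); apply: le_trans ag0 _.
by rewrite le_eqVlt; apply/orP; left; apply/eqP; rewrite /a /g; ring.
Qed.

Lemma radial_touch (y : 'rV[R]_n.+1) (F F1 : R -> R) F2 x :
  O x -> 0 < u x -> u x = F (sqd y x) ->
  (\forall w \near x, F (sqd y w) <= u w) ->
  (\forall t \near sqd y x, is_derive (t : R) (1 : R) F (F1 t)) ->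
  is_derive (sqd y x) (1 : R) F1 F2 ->
  F1 (sqd y x) * (u x + 2 * sqd y x * F1 (sqd y x) / (m - 2)) <= 0 /\
  0 <= - (1 + mu) * 4 * F1 (sqd y x) / (m - 2) *
         (u x + 2 * sqd y x * F1 (sqd y x) / (m - 2)) +
    sqd y x * (- 8 * F2 * u x / (m - 2) +
               8 * m * F1 (sqd y x) ^+ 2 / (m - 2) ^+ 2).
Proof.
move=> Ox ux uF le_u dF dF1.
have quad_touch d : 0 < d ->
    \forall w \near x, u x + quad y (F1 (sqd y x)) ((F2 - d) / 2) (sqd y x) w <= u w.
  move=> d0; have := taylor2_lower dF dF1 d0; rewrite -uF.
  move=> /(@continuous_sqd R n.+1 y x); rewrite nbhs_filterE.
  move: le_u; apply: filterS2 => w Fu /= Tw.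
  by rewrite /quad addrA; exact: le_trans Tw Fu.
(* The first inequality does not involve the second derivative, so any loss, here 1, is
   admissible. *)
split; first by have [] := radial_touch_quad Ox ux (quad_touch 1 ltr01).
apply/ler_addgt0Pr => e e0.
(* The rate at which the second inequality depends on the loss d; it may vanish, hence the divisor
   [K + 1] below. *)
pose K := 8 * sqd y x * u x / (m - 2).
have K0 : 0 <= K.
  by rewrite divr_ge0 ?(ltW m2_gt0)// !mulr_ge0 ?sqd_ge0// ltW.
have K1 : 0 < K + 1 by rewrite ltr_wpDl.
have [_ H] := radial_touch_quad Ox ux (quad_touch _ (divr_gt0 e0 K1)).
apply: le_trans H _.
set A := - (1 + mu) * _ * _ / _ * _.
have -> : A + sqd y x * (- 16 * ((F2 - e / (K + 1)) / 2) * u x / (m - 2) +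
    8 * m * F1 (sqd y x) ^+ 2 / (m - 2) ^+ 2) =
  A + sqd y x * (- 8 * F2 * u x / (m - 2) +
    8 * m * F1 (sqd y x) ^+ 2 / (m - 2) ^+ 2) + K * (e / (K + 1)).
  by move: K1 => /gt_eqF/negbT; rewrite /K; set t := e / _ => _; field; exact: m2_neq0.
by rewrite lerD2l mulrCA ler_piMr ?ltW// ltr_pdivrMr// mul1r ltrDl.
Qed.

End Touching.

(** * Touching conditions *)

Lemma ler_powRN (R : realType) (a b r : R) : 0 <= r -> 0 < a -> a <= b ->
  b `^ (- r) <= a `^ (- r).
Proof.
move=> r0 a0 ab; have b0 := lt_le_trans a0 ab.
rewrite !powRN lef_pV2 ?posrE ?powR_gt0//.
by apply: ge0_ler_powR; rewrite ?nnegrE// ltW.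
Qed.

(* Here h is a function of the squared distance s = r^2 to y; as a function of r
   it satisfies 0 <= r h' <= b h and h'' + (1 - b) h' / r >= 0. *)
Definition radial_touching (R : realType) n (b : R) (O : set 'rV[R]_n)
    (V : 'rV[R]_n -> R) :=
  forall (y x : 'rV[R]_n) (h h1 : R -> R) h2, O x -> V x = h (sqd y x) ->
  (\forall w \near x, V w <= h (sqd y w)) ->
  (\forall t \near sqd y x, is_derive (t : R) (1 : R) h (h1 t)) ->
  is_derive (sqd y x) (1 : R) h1 h2 ->
  [/\ 0 <= h1 (sqd y x), 2 * sqd y x * h1 (sqd y x) <= b * h (sqd y x)
    & 0 <= (2 - b) * h1 (sqd y x) + 2 * sqd y x * h2].

(** With P = h^(-N), H = h, A = h', B = h'', the left-hand sides are the touching expressions for u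
    = h^(-N) in dimension N b + 2. In the second one the terms in A^2 cancel, which leaves a linear
    expression in the derivatives. *)
Lemma power_touch_algebra (R : realFieldType) (N b P H A B s : R) :
  N != 0 -> b != 0 -> H != 0 ->
  - N * (P / H * A) * (P + 2 * s * (- N * (P / H * A)) / (N * b)) =
    - (N * P ^+ 2 / H ^+ 2 / b * (A * (b * H - 2 * s * A))) /\
  - (2 - b) * 4 * (- N * (P / H * A)) / (N * b) *
      (P + 2 * s * (- N * (P / H * A)) / (N * b)) +
    s * (- 8 * (- N * (P / H * B + A * ((- N - 1) * (P / H / H) * A))) * P / (N * b) +
         8 * (N * b + 2) * (- N * (P / H * A)) ^+ 2 / (N * b) ^+ 2) =
    4 * P ^+ 2 / (b * H) * ((2 - b) * A + 2 * s * B).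
Proof.
by move=> N0 b0 H0; split; field; rewrite ?N0 ?b0 ?H0.
Qed.

Section PowerTouching.
Variables (R : realType) (n : nat) (G : set 'rV[R]_n.+1) (mu : R).
Hypotheses (n_ge3 : (3 <= n.+1)%N) (G_open : open G)
  (G_convex : convex_set (G : set (convex_lmodType 'rV[R]_n.+1)))
  (G_symmetric : symmetric_set G) (G_cone : is_cone G)
  (G_pos : [set l : 'rV[R]_n.+1 | forall i, 0 < l 0 i] `<=` G)
  (G_trace : G `<=` [set l : 'rV[R]_n.+1 | 0 < \sum_(i < n.+1) l 0 i])
  (G_axis : boundary G (head_tail n.+1 1 0))
  (mu_ge0 : 0 <= mu) (mu_plus : boundary G (head_tail n.+1 (- mu) 1))
  (mu_lt1 : mu < 1).
Variables (O : set 'rV[R]_n.+1) (u : 'rV[R]_n.+1 -> R).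
Hypotheses (O_open : open O) (u_gt0 : forall x, O x -> 0 < u x)
  (visc : viscosity_in G O u).

Let m : R := n.+1%:R.

Let m2_gt0 : 0 < m - 2.
Proof. by rewrite subr_gt0 /m ltr_nat. Qed.

Let m2_neq0 : 1 + n%:R - 2 != 0 :> R.
Proof. by rewrite [1 + _]addrC natr1 gt_eqF. Qed.

Lemma power_radial_touching :
  radial_touching (1 - mu) O (fun x => u x `^ ((mu - 1) / (m - 2))).
Proof.
move=> y x h h1 h2 Ox Vx leV dh dh1; set s := sqd y x.
pose b : R := 1 - mu; have b0 : 0 < b by rewrite subr_gt0.
pose N : R := (m - 2) / b; have N0 : 0 < N by rewrite divr_gt0.
have uE w : 0 < u w -> u w = (u w `^ ((mu - 1) / (m - 2))) `^ (- N).
  move=> uw; rewrite -powRrM.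
  have -> : (mu - 1) / (m - 2) * - N = 1.
    by rewrite /N /b; field; rewrite m2_neq0/= subr_eq0 gt_eqF.
  by rewrite powRr1// ltW.
have ux := u_gt0 Ox.
have hs : 0 < h s by rewrite -Vx powR_gt0.
have [dhs _] := nbhs_singleton dh.
have h_cont : {for s, continuous h}.
  by apply: differentiable_continuous; exact/derivable1_diffP.
have h_pos : \forall t \near s, 0 < h t.
  have /cvgrPdist_lt/(_ _ hs) := h_cont; apply: filterS => t.
  by rewrite ltr_norml => /andP[_]; rewrite ltrBlDr ltrDl.
pose F t := h t `^ (- N).
pose F1 t := - N * (h t `^ (- N - 1) * h1 t).
pose F2 := - N * (h s `^ (- N - 1) * h2 + h1 s * ((- N - 1) * h s `^ (- N - 1 - 1) * h1 s)).
have dF : \forall t \near s, is_derive (t : R) (1 : R) F (F1 t).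
  move: dh h_pos; apply: filterS2 => t dht ht.
  apply: is_derive_eq (is_derive1_comp (is_derive1_powR (- N) ht) dht) _.
  by rewrite /F1 mulrA.
have dF1 : is_derive s (1 : R) F1 F2.
  have dhss := nbhs_singleton dh.
  exact: (is_derive_scale (- N)
    (is_derive_mul (is_derive1_comp (is_derive1_powR (- N - 1) hs) dhss) dh1)).
have leF : \forall w \near x, F (sqd y w) <= u w.
  have nO : nbhs x O by exact: open_nbhs_nbhs.
  move: nO leV; apply: filterS2 => w Ow Vw.
  rewrite (uE _ (u_gt0 Ow)); apply: ler_powRN => //; first exact: ltW.
  by rewrite powR_gt0// u_gt0.
have uF : u x = F s by rewrite (uE _ ux) Vx.
have [] := radial_touch n_ge3 G_open G_convex G_symmetric G_cone G_pos
  G_trace G_axis mu_ge0 mu_plus visc Ox ux uF leF dF dF1.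
rewrite -/s -/m uF /F1 /F2 /F.
have pB p : h s `^ (p - 1) = h s `^ p / h s.
  by rewrite powRB ?powRr1 ?(ltW hs)// (gt_eqF hs) implybT.
rewrite !pB.
have P0 : 0 < h s `^ (- N) by rewrite powR_gt0.
have mE : m - 2 = N * b by rewrite divfK// gt_eqF.
have mE' : m = N * b + 2 by rewrite -mE subrK.
have muE : 1 + mu = 2 - b by rewrite /b; ring.
have [E1 E2] := power_touch_algebra (h s `^ (- N)) (h1 s) h2 s
  (lt0r_neq0 N0) (lt0r_neq0 b0) (lt0r_neq0 hs).
rewrite muE mE mE' E1 E2 -/b.
rewrite oppr_le0 pmulr_rge0; last by rewrite !divr_gt0 ?mulr_gt0 ?invr_gt0 ?exprn_gt0 ?powR_gt0//.
move=> H1; rewrite pmulr_rge0; last by rewrite !divr_gt0 ?mulr_gt0 ?invr_gt0 ?exprn_gt0 ?powR_gt0//.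
move=> H2; have s0 := sqd_ge0 y x; rewrite -/s in s0.
(* If h' < 0, then b h - 2 s h' > 0 and the product in [H1] would be negative. *)
have h1_ge0 : 0 <= h1 s.
  rewrite leNgt; apply/negP => h1_lt0.
  move: H1; rewrite nmulr_rge0// leNgt subr_gt0 (@le_lt_trans _ _ 0)//.
    by rewrite mulr_ge0_le0 ?mulr_ge0// ltW.
  exact: mulr_gt0.
split=> //.
move: h1_ge0; rewrite le_eqVlt => /orP[/eqP <-|h1_gt0].
  by rewrite mulr0 mulr_ge0// ltW.
by move: H1; rewrite pmulr_rge0// subr_ge0.
Qed.

End PowerTouching.

(** * Superharmonicity of the solution in the touching sense *)

Section LaplaceTouching.
Variables (R : realType) (n : nat) (G : set 'rV[R]_n.+1).
Hypotheses (n_ge3 : (3 <= n.+1)%N)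
  (G_convex : convex_set (G : set (convex_lmodType 'rV[R]_n.+1)))
  (G_cone : is_cone G)
  (G_pos : [set l : 'rV[R]_n.+1 | forall i, 0 < l 0 i] `<=` G)
  (G_trace : G `<=` [set l : 'rV[R]_n.+1 | 0 < \sum_(i < n.+1) l 0 i]).
Variables (O : set 'rV[R]_n.+1) (u : 'rV[R]_n.+1 -> R).
Hypothesis visc : viscosity_in G O u.

Let m : R := n.+1%:R.

Let m2_gt0 : 0 < m - 2.
Proof. by rewrite subr_gt0 /m ltr_nat. Qed.

Let m2_neq0 : 1 + n%:R - 2 != 0 :> R.
Proof. by rewrite [1 + _]addrC natr1 gt_eqF. Qed.

Lemma sum_quad2_diag (y : 'rV[R]_n.+1) c1 c2 x :
  \sum_(i < n.+1) quad2 y c1 c2 (sqd y x) i i x = 2 * m * c1 + 8 * c2 * sqd y x.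
Proof.
rewrite (eq_bigr (fun i => 2 * c1 + 8 * c2 * (x 0 i - y 0 i) ^+ 2)).
  rewrite big_split/= sumr_const card_ord -mulr_sumr -/(sqd _ _).
  by rewrite -[(2 * c1) *+ _]mulr_natr -/m; ring.
by move=> i _; rewrite /quad2 eqxx subrr /=; ring.
Qed.

(** In the trace of the conformal matrix the two gradient terms cancel; what remains is a negative
    multiple of the Laplacian of the test function. *)
Lemma laplace_touch_quad (y z : 'rV[R]_n.+1) c1 c2 d1 d2 x : O x -> 0 < u x ->
  (\forall w \near x, u x + (quad y c1 c2 (sqd y x) w + quad z d1 d2 (sqd z x) w) <= u w) ->
  2 * m * c1 + 8 * c2 * sqd y x + (2 * m * d1 + 8 * d2 * sqd z x) <= 0.
Proof.
move=> Ox ux le_u.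
have [l [El Gl]] := test_fun_touch visc Ox le_u.
have := closure_cone_trace G_convex G_cone G_pos G_trace Gl.
rewrite -(char_poly_prod_trace El) /mxtrace.
set f := test_fun _ _ _ _ _ _ _ _ _.
have fx : f x = u x by exact: test_fun_center.
pose k := u x `^ (- (2 * m / (m - 2))).
have k0 : 0 < k by rewrite powR_gt0.
pose g := enorm (gradient f x) ^+ 2.
rewrite (eq_bigr (fun i => - (2 / (m - 2) * k * u x) *
    (quad2 y c1 c2 (sqd y x) i i x + quad2 z d1 d2 (sqd z x) i i x) +
  (2 * m / (m - 2) ^+ 2 * k * (gradient f x 0 i ^+ 2) - 2 / (m - 2) ^+ 2 * k * g))); last first.
  move=> i _; rewrite !mxE -/m -/g eqxx fx conformal_powR// -/k.
  by rewrite /f partial2_test_fun /=; ring.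
rewrite !big_split/= sumr_const card_ord -!mulr_sumr -enorm_sqr -/g.
rewrite -[(- _) *+ _]mulr_natr -/m big_split/= !sum_quad2_diag.
have -> : 2 * m / (m - 2) ^+ 2 * k * g + - (2 / (m - 2) ^+ 2 * k * g) * m = 0 by ring.
rewrite addr0 mulNr oppr_ge0 pmulr_rle0// mulr_gt0// mulr_gt0// divr_gt0//.
Qed.

Lemma laplace_touch (y z : 'rV[R]_n.+1) (F F1 : R -> R) F2 (K K1 : R -> R) K2 x :
  O x -> 0 < u x -> u x = F (sqd y x) + K (sqd z x) ->
  (\forall w \near x, F (sqd y w) + K (sqd z w) <= u w) ->
  (\forall t \near sqd y x, is_derive (t : R) (1 : R) F (F1 t)) ->
  is_derive (sqd y x) (1 : R) F1 F2 ->
  (\forall t \near sqd z x, is_derive (t : R) (1 : R) K (K1 t)) ->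
  is_derive (sqd z x) (1 : R) K1 K2 ->
  2 * m * F1 (sqd y x) + 4 * sqd y x * F2 +
  (2 * m * K1 (sqd z x) + 4 * sqd z x * K2) <= 0.
Proof.
move=> Ox ux uFK le_u dF dF1 dK dK1.
apply/ler_addgt0Pr => e e0; rewrite add0r.
pose L := 4 * (sqd y x + sqd z x).
have L0 : 0 <= L by rewrite mulr_ge0// addr_ge0// sqd_ge0.
have L1 : 0 < L + 1 by rewrite ltr_wpDl.
pose d := e / (L + 1); have d0 : 0 < d by rewrite divr_gt0.
have quad_touch : \forall w \near x,
    u x + (quad y (F1 (sqd y x)) ((F2 - d) / 2) (sqd y x) w +
           quad z (K1 (sqd z x)) ((K2 - d) / 2) (sqd z x) w) <= u w.
  have := taylor2_lower dF dF1 d0 => /(@continuous_sqd R n.+1 y x) HF.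
  have := taylor2_lower dK dK1 d0 => /(@continuous_sqd R n.+1 z x) HK.
  near=> w.
  have h1 : F (sqd y w) + K (sqd z w) <= u w by near: w.
  apply: le_trans h1; rewrite uFK addrACA lerD// /quad addrA.
    by near: w.
  by near: w.
have := laplace_touch_quad Ox ux quad_touch.
have Ld : L * d <= e by rewrite /d mulrCA ler_piMr ?ltW// ltr_pdivrMr// mul1r ltrDl.
rewrite /L in Ld; lra.
Unshelve. all: by end_near. Qed.

End LaplaceTouching.

(** * Comparison with radial functions *)

Definition usc_in (R : realType) n (A : set 'rV[R]_n) (f : 'rV[R]_n -> R) :=
  forall x a, A x -> f x < a ->
    exists2 d, 0 < d & forall z, A z -> enorm (z - x) < d -> f z < a.

Lemma usc_in_sub (R : realType) n (A B : set 'rV[R]_n) (f : 'rV[R]_n -> R) :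
  B `<=` A -> usc_in A f -> usc_in B f.
Proof.
move=> BA uf x a Bx fx; have [d d0 dP] := uf x a (BA _ Bx) fx.
by exists d => // z Bz; exact/dP/BA.
Qed.

Lemma lsc_in_sub_mul (R : realType) n (A : set 'rV[R]_n) (f g k : 'rV[R]_n -> R) :
  usc_in A f -> (forall x, A x -> 0 <= k x) ->
  (forall x, A x -> continuous_at x g) -> (forall x, A x -> continuous_at x k) ->
  lsc_in A (fun x => g x - k x * f x).
Proof.
move=> uf k0 cg ck x a Ax ax.
have k1 : 0 < k x + 1 by rewrite ltr_wpDl// k0.
(* t exceeds f x by so little that g x - k x t keeps at least half of the gap above a; the [+ 1]
   covers k x = 0. *)
pose t := f x + (g x - k x * f x - a) / (2 * (k x + 1)).
have ft : f x < t by rewrite ltrDl divr_gt0 ?mulr_gt0// subr_gt0.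
have at_ : a < g x - k x * t.
  rewrite /t mulrDr opprD addrA.
  set w := g x - _ in ax *.
  have -> : k x * ((w - a) / (2 * (k x + 1))) = (w - a) * (k x / (2 * (k x + 1))) by ring.
  have : k x / (2 * (k x + 1)) <= 2^-1.
    by rewrite ler_pdivrMr ?mulr_gt0//; have := k0 x Ax; lra.
  have wa : 0 < w - a by rewrite subr_gt0.
  by move=> /(ler_wpM2l (ltW wa)); lra.
have [d d0 dP] := uf x t Ax ft.
have : \forall z \near x, a < g z - k z * t.
  have C : continuous_at x (fun z => g z - k z * t).
    apply: continuous_at_sub; first exact: cg.
    by apply: continuous_at_mul; [exact: ck|exact: cst_continuous].
  have wa : 0 < g x - k x * t - a by rewrite subr_gt0.
  move: C => /cvgrPdist_lt/(_ _ wa); apply: filterS => z.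
  by rewrite ltr_norml => /andP[_]; lra.
move=> /nbhs_enormP[e e0 eP].
exists (Num.min d e); first by rewrite lt_min d0.
move=> z Az; rewrite lt_min => /andP[zd ze].
apply: lt_le_trans (eP _ ze) _.
by rewrite lerB// ler_wpM2l ?k0// ltW// dP.
Qed.

Lemma usc_in_bounded (R : realType) n (A : set 'rV[R]_n) (f : 'rV[R]_n -> R) :
  compact A -> usc_in A f -> exists K, forall x, A x -> f x <= K.
Proof.
move=> cA uf; have [A0|/set0P/negP/negPn/eqP A0] := pselect (A !=set0); last first.
  by exists 0 => x; rewrite A0.
have L := lsc_in_sub_mul uf (fun x _ => ler01 : 0 <= (fun=> 1 : R) x)
  (fun x _ => @cst_continuous _ _ (0 : R) x) (fun x _ => @cst_continuous _ _ (1 : R) x).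
have [x Ax xmin] := lsc_in_min cA A0 L.
by exists (f x) => z Az; have := xmin z Az; rewrite /= !mul1r; lra.
Qed.

(** A profile with this property cannot touch V from above at squared distance s, since some
    conclusion of [radial_touching] fails. *)
Definition strict_at (R : realType) (b : R) (h : R -> R) (s : R) :=
  exists (h1 : R -> R) h2,
    [/\ \forall t \near s, is_derive (t : R) (1 : R) h (h1 t),
        is_derive s (1 : R) h1 h2
      & ~ [/\ 0 <= h1 s, 2 * s * h1 s <= b * h s & 0 <= (2 - b) * h1 s + 2 * s * h2]].

Lemma sqr_powR_half (R : realType) (r b : R) : 0 <= r -> (r ^+ 2) `^ (b / 2) = r `^ b.
Proof. by move=> r0; rewrite -powR_mulrn// -powRrM; congr (_ `^ _); field. Qed.

Section Comparison.
Variables (R : realType) (n : nat) (b : R) (O : set 'rV[R]_n.+1)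
  (V : 'rV[R]_n.+1 -> R).
Hypotheses (b_gt0 : 0 < b) (b_le1 : b <= 1)
  (V_gt0 : forall x, O x -> 0 < V x)
  (V_usc : usc_in O V) (V_touch : radial_touching b O V).

(** At a minimum x0 of g - V / j with negative value, raising g by the absolute value c of the
    minimum makes (g + c) j touch V from above; the bounds on the two spheres put x0 inside the
    annulus. The factor j permits additive perturbations, for j = 1, and multiplicative ones, for j
    = t^(b/2). *)
Lemma annulus_comparison y (r R1 : R) (g j : R -> R) :
  0 <= r -> (forall x, r <= enorm (x - y) <= R1 -> O x) ->
  (forall s, r ^+ 2 <= s <= R1 ^+ 2 -> [/\ continuous_at s g, continuous_at s j & 0 < j s]) ->
  (forall c s, 0 < c -> r ^+ 2 < s < R1 ^+ 2 -> strict_at b (fun t => (g t + c) * j t) s) ->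
  (forall x, enorm (x - y) = r -> O x -> V x <= g (r ^+ 2) * j (r ^+ 2)) ->
  (forall x, enorm (x - y) = R1 -> O x -> V x <= g (R1 ^+ 2) * j (R1 ^+ 2)) ->
  forall x, r <= enorm (x - y) <= R1 -> V x <= g (sqd y x) * j (sqd y x).
Proof.
move=> r0 AO gj strict bdr bdR x Ax.
pose A := [set x : 'rV[R]_n.+1 | r <= enorm (x - y) <= R1].
have As z : A z -> r ^+ 2 <= sqd y z <= R1 ^+ 2.
  move=> /andP[z1 z2]; rewrite sqdE.
  by rewrite !lerXn2r// ?nnegrE ?enorm_ge0// (le_trans r0)// (le_trans z1).
have cs : continuous (sqd y) by exact: continuous_sqd.
have L : lsc_in A (fun z => g (sqd y z) - (j (sqd y z))^-1 * V z).
  apply: lsc_in_sub_mul; first exact: usc_in_sub V_usc.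
  - by move=> z /As/gj[_ _ j0]; rewrite invr_ge0 ltW.
  - by move=> z /As/gj[cg _ _]; apply: continuous_comp; [exact: cs|exact: cg].
  - move=> z /As/gj[_ cj j0].
    apply: (@continuous_comp _ _ _ (fun z => sqd y z) (fun t => (j t)^-1)); first exact: cs.
    by apply: cvgV => //; rewrite gt_eqF.
have [x0 Ax0 x0min] := lsc_in_min (@compact_annulus R n.+1 y r R1) (ex_intro _ x Ax) L.
have [_ _ j0] := gj _ (As _ Ax).
rewrite -ler_pdivrMr// mulrC -subr_ge0; apply: le_trans (x0min x Ax) => {j0}.
rewrite leNgt; apply/negP; set c := _ - _ => c0.
have [_ _ j0] := gj _ (As _ Ax0).
have Vx0 : V x0 = (g (sqd y x0) + - c) * j (sqd y x0).
  by rewrite /c; field; rewrite gt_eqF.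
have nc0 : 0 < - c by rewrite oppr_gt0.
have noteq : V x0 <= g (sqd y x0) * j (sqd y x0) -> False.
  by rewrite Vx0 ler_pM2r// gerDl leNgt nc0.
have Ox0 := AO _ Ax0.
have [x0r x0R] : r < enorm (x0 - y) /\ enorm (x0 - y) < R1.
  move: (Ax0) => /andP[]; rewrite !le_eqVlt => /orP[/eqP e1|->] /orP[/eqP e2|-> //].
  - by case: noteq; rewrite sqdE -e1; exact: bdr.
  - by case: noteq; rewrite sqdE -e1; exact: bdr.
  - by case: noteq; rewrite sqdE e2; exact: bdR.
have s0 : r ^+ 2 < sqd y x0 < R1 ^+ 2.
  by rewrite sqdE !ltrXn2r// ?nnegrE ?enorm_ge0// (le_trans (enorm_ge0 (x0 - y)))// ltW.
have [h1 [h2 [dh dh1 bad]]] := strict _ _ nc0 s0.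
apply: bad; apply: (V_touch (h := fun t => (g t + - c) * j t)) Ox0 Vx0 _ dh dh1.
have nA : \forall z \near x0, A z.
  pose e := Num.min (enorm (x0 - y) - r) (R1 - enorm (x0 - y)).
  apply/nbhs_enormP; exists e; first by rewrite lt_min !subr_gt0 x0r.
  move=> z; rewrite lt_min => /andP[z1 z2]; apply/andP; split.
    have := enorm_triangle z x0 y; rewrite (enorm_distC x0 z); lra.
  by have := enorm_triangle x0 z y; lra.
apply: filterS nA => z Az; have [_ _ jz] := gj _ (As _ Az).
rewrite -ler_pdivrMr// mulrC; have := x0min z Az; rewrite -/c; lra.
Qed.

(** The centre need not lie in O: only an asymptotic upper bound c is assumed there, which serves
    interior points and the puncture alike. *)
Lemma radial_comparison y (R1 c M : R) : 0 < R1 -> c <= M ->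
  (forall x, 0 < enorm (x - y) <= R1 -> O x) ->
  (forall e, 0 < e -> exists2 d, 0 < d & forall x, O x -> enorm (x - y) < d -> V x < c + e) ->
  (forall x, enorm (x - y) = R1 -> O x -> V x <= M) ->
  forall x, 0 < enorm (x - y) <= R1 ->
    V x <= c + (M - c) * (enorm (x - y) / R1) `^ b.
Proof.
move=> R10 cM AO center bd x /andP[x0 xR]; apply/ler_addgt0Pr => e e0.
have e20 : 0 < e / 2 by rewrite divr_gt0.
have [d d0 dP] := center _ e20.
pose r := Num.min (d / 2) (enorm (x - y)).
have r0 : 0 < r by rewrite lt_min divr_gt0.
have rx : r <= enorm (x - y) by rewrite ge_min lexx orbT.
pose a := (M - c) / R1 `^ b.
have a0 : 0 <= a by rewrite divr_ge0 ?powR_ge0// subr_ge0.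
(* The correction vanishes on the outer sphere and costs at most eps R1^2 = e / 2 at x. Its
   derivative -eps turns the second-order equality for c + a t^(b/2) into strict failure. *)
pose eps := e / 2 / R1 ^+ 2; have eps0 : 0 < eps by rewrite divr_gt0 ?exprn_gt0.
pose g t := c + e / 2 + a * t `^ (b / 2) + eps * (R1 ^+ 2 - t).
have dg t : 0 < t -> is_derive (t : R) (1 : R) g (a * (b / 2 * t `^ (b / 2 - 1)) - eps).
  move=> t0; have D := is_derive_scale a (is_derive1_powR (b / 2) t0).
  have I := is_derive_scale eps (is_derive_add (is_derive_const t (1 : R) (R1 ^+ 2))
    (is_derive_scale (-1) (is_derive_id t (1 : R)))).
  have := is_derive_add (is_derive_add (is_derive_const t (1 : R) (c + e / 2)) D) I.
  have -> : (fun z => c + e / 2 + a * z `^ (b / 2) + eps * (R1 ^+ 2 + -1 * z)) = g.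
    by apply/funext => z; rewrite mulN1r.
  by move=> /is_derive_eq; apply; ring.
have H : forall x, r <= enorm (x - y) <= R1 -> V x <= g (sqd y x) * 1.
  apply: (@annulus_comparison y r R1 g (fun=> 1)); first exact: ltW.
  - by move=> z /andP[z1 z2]; apply: AO; rewrite z2 (lt_le_trans r0).
  - move=> s /andP[rs sR]; split=> //; last exact: cst_continuous.
    have [ds _] := dg s (lt_le_trans (exprn_gt0 2 r0) rs).
    by apply: differentiable_continuous; exact/derivable1_diffP.
  - move=> k s k0 /andP[rs sR]; have s0 := lt_trans (exprn_gt0 2 r0) rs.
    exists (fun t => a * (b / 2 * t `^ (b / 2 - 1)) - eps).
    exists (a * (b / 2 * ((b / 2 - 1) * s `^ (b / 2 - 1 - 1)))); split.
    + have -> : (fun t => (g t + k) * 1) = (fun t => g t + k).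
        by apply/funext => t; rewrite mulr1.
      have : \forall t \near s, 0 < t by exact: lt_nbhsr.
      apply: filterS => t t0.
      by have := is_derive_add (dg t t0) (is_derive_const t (1 : R) k); rewrite addr0.
    + exact: (is_derive_sub_const eps (is_derive_scale a (is_derive_scale (b / 2)
        (is_derive1_powR (b / 2 - 1) s0)))).
    + have -> : s `^ (b / 2 - 1 - 1) = s `^ (b / 2 - 1) / s.
        by rewrite powRB ?powRr1 ?(ltW s0) ?(gt_eqF s0) ?implybT.
      move=> [_ _].
      have -> : (2 - b) * (a * (b / 2 * s `^ (b / 2 - 1)) - eps) +
         2 * s * (a * (b / 2 * ((b / 2 - 1) * (s `^ (b / 2 - 1) / s)))) = - ((2 - b) * eps).
        by field; rewrite gt_eqF.
      by rewrite oppr_ge0 leNgt mulr_gt0// subr_gt0 (le_lt_trans b_le1)// ltr1n.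
  - move=> z zr Oz; rewrite mulr1.
    have rd : r < d.
      have : r <= d / 2 by rewrite ge_min lexx.
      by lra.
    have zd : enorm (z - y) < d by rewrite zr.
    apply: le_trans (ltW (dP z Oz zd)) _.
    have rR : r ^+ 2 <= R1 ^+ 2 by rewrite lerXn2r// ?nnegrE ?(ltW r0) ?(ltW R10)// (le_trans rx).
    by rewrite /g -addrA lerDl addr_ge0// mulr_ge0 ?powR_ge0 ?subr_ge0 ?(ltW eps0).
  - move=> z zR Oz; rewrite mulr1 (le_trans (bd z zR Oz))// /g subrr mulr0 addr0.
    by rewrite sqr_powR_half ?ltW// /a divfK ?gt_eqF ?powR_gt0//; lra.
apply: le_trans (H x _) _; first by rewrite rx.
rewrite mulr1 /g sqdE sqr_powR_half ?enorm_ge0//.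
rewrite powRM ?invr_ge0 ?enorm_ge0 ?(ltW R10)//.
have -> : R1^-1 `^ b = (R1 `^ b)^-1.
  by rewrite -powR_inv1 ?(ltW R10)// -powRrM mulN1r powRN.
have -> : a * enorm (x - y) `^ b = (M - c) * (enorm (x - y) `^ b / R1 `^ b).
  by rewrite /a; ring.
have : eps * (R1 ^+ 2 - enorm (x - y) ^+ 2) <= e / 2.
  rewrite mulrBr /eps divfK ?gt_eqF ?exprn_gt0// gerBl.
  by rewrite !mulr_ge0 ?invr_ge0 ?exprn_ge0 ?enorm_ge0// ltW.
lra.
Qed.

End Comparison.

Lemma is_derive_exp_affine (R : realType) (L k p t : R) :
  is_derive t (1 : R) (fun t => L * expR (k * (t - p))) (k * (L * expR (k * (t - p)))).
Proof.
have D := is_derive_scale k (is_derive_sub_const p (is_derive_id t (1 : R))).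
have := is_derive_scale L (@is_derive1_comp R expR (fun z => k * (z - p)) t _ _
  (is_derive_expR (k * (t - p))) D).
by move=> /is_derive_eq; apply; ring.
Qed.

Lemma exp_decay (R : realType) (L d e : R) : 0 < L -> 0 < d -> 0 < e ->
  (* k is chosen with k d = L / e, and exp(L / e) >= L / e. *)
  exists2 k, 0 < k & L * expR (k * - d) <= e.
Proof.
move=> L0 d0 e0; exists (L / e / d); first by rewrite !divr_gt0.
rewrite mulrN divfK ?gt_eqF// expRN ler_pdivrMr ?expR_gt0//.
rewrite mulrC -ler_pdivrMr//; apply: le_trans (expR_ge1Dx _).
by rewrite lerDr.
Qed.

Section ExtremalRadii.
Variables (R : realType) (n : nat) (b : R) (O : set 'rV[R]_n.+1)
  (V : 'rV[R]_n.+1 -> R).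
Hypotheses (b_gt0 : 0 < b) (b_le1 : b <= 1)
  (V_gt0 : forall x, O x -> 0 < V x)
  (V_usc : usc_in O V) (V_touch : radial_touching b O V).

(** No inner bound is needed: a decreasing exponential that dominates V on a small sphere violates
    h' >= 0 everywhere, so it is an admissible barrier, and a large rate k brings it within e of M
    at x. *)
Lemma outer_sphere_max y (R1 M : R) :
  (forall x, 0 < enorm (x - y) <= R1 -> O x) ->
  (forall x, enorm (x - y) = R1 -> O x -> V x <= M) ->
  forall x, 0 < enorm (x - y) <= R1 -> V x <= M.
Proof.
move=> AO bd x /andP[x0 xR]; apply/ler_addgt0Pr => e e0.
pose r := enorm (x - y) / 2; have r0 : 0 < r by rewrite divr_gt0.
have rx : r < enorm (x - y) by rewrite /r; lra.
have AO' z : r <= enorm (z - y) <= R1 -> O z.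
  by move=> /andP[z1 z2]; apply: AO; rewrite z2 (lt_le_trans r0).
have [K KV] := usc_in_bounded (@compact_annulus R n.+1 y r R1) (usc_in_sub AO' V_usc).
pose L := `|K - M| + 1; have L0 : 0 < L by rewrite ltr_wpDl.
have d0 : 0 < enorm (x - y) ^+ 2 - r ^+ 2.
  by rewrite subr_gt0 ltrXn2r// ltW.
have [k k0 kP] := exp_decay L0 d0 e0.
pose g t := M + L * expR (- k * (t - r ^+ 2)).
have dg t c : is_derive (t : R) (1 : R) (fun t => (g t + c) * 1)
    (- k * (L * expR (- k * (t - r ^+ 2)))).
  have -> : (fun t => (g t + c) * 1) = (fun t => M + L * expR (- k * (t - r ^+ 2)) + c).
    by apply/funext => z; rewrite mulr1.
  have := is_derive_add (is_derive_add (is_derive_const t (1 : R) M)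
    (is_derive_exp_affine L (- k) (r ^+ 2) t)) (is_derive_const t (1 : R) c).
  by rewrite addr0 add0r.
have H := annulus_comparison (j := fun=> 1) (g := g) V_usc V_touch (ltW r0) AO'.
have : V x <= g (sqd y x) * 1.
  apply: H; last by rewrite ltW.
  - move=> s _; split=> //; last exact: cst_continuous.
    have [ds _] := dg s 0.
    have -> : g = (fun t => (g t + 0) * 1) by apply/funext => t; rewrite addr0 mulr1.
    by apply: differentiable_continuous; exact/derivable1_diffP.
  - move=> c s _ _.
    exists (fun t => - k * (L * expR (- k * (t - r ^+ 2)))).
    exists (- k * (- k * (L * expR (- k * (s - r ^+ 2))))); split.
    + by apply: (@filterE _ (nbhs s)) => t; exact: dg.
    + exact: (is_derive_scale (- k) (is_derive_exp_affine L (- k) (r ^+ 2) s)).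
    + by move=> [+ _ _]; rewrite mulNr oppr_ge0 leNgt !mulr_gt0// expR_gt0.
  - move=> z zr Oz; rewrite mulr1 /g subrr mulr0 expR0 mulr1.
    have := KV z; rewrite /= zr lexx (le_trans (ltW rx))// => /(_ isT) Vz.
    by have := ler_norm (K - M); rewrite /L; lra.
  - move=> z zR Oz; rewrite mulr1 (le_trans (bd _ zR Oz))// lerDl.
    by rewrite mulr_ge0 ?expR_ge0// ltW.
rewrite mulr1 /g sqdE => /le_trans; apply; rewrite lerD2l.
by rewrite mulNr -mulrN.
Qed.

(** The profile (c + L exp(k (t - R1^2))) t^(b/2) violates r h' <= b h, so it may be as large as
    needed on the outer sphere, while a large k brings it as close to c r^b at x as desired. *)
Lemma inner_sphere_max y (r R1 c : R) : 0 < r ->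
  (forall x, r <= enorm (x - y) <= R1 -> O x) ->
  (forall x, enorm (x - y) = r -> O x -> V x <= c * r `^ b) ->
  forall x, r <= enorm (x - y) < R1 -> V x <= c * enorm (x - y) `^ b.
Proof.
move=> r0 AO bd x /andP[rx xR].
have x0 := lt_le_trans r0 rx; have R10 := lt_trans x0 xR.
have xb0 : 0 < enorm (x - y) `^ b by rewrite powR_gt0.
rewrite -ler_pdivrMr//; apply/ler_addgt0Pr => e e0; rewrite ler_pdivrMr//.
have [K KV] := usc_in_bounded (@compact_annulus R n.+1 y r R1) (usc_in_sub AO V_usc).
pose L := `|K| / R1 `^ b + `|c| + 1.
have L0 : 0 < L by rewrite ltr_wpDl// addr_ge0// divr_ge0// powR_ge0.
have d0 : 0 < R1 ^+ 2 - enorm (x - y) ^+ 2.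
  by rewrite subr_gt0 ltrXn2r// ltW.
have [k k0 kP] := exp_decay L0 d0 e0.
pose g t := c + L * expR (k * (t - R1 ^+ 2)).
pose j (t : R) := t `^ (b / 2).
have dg t c' : is_derive (t : R) (1 : R) (fun t => g t + c')
    (k * (L * expR (k * (t - R1 ^+ 2)))).
  have := is_derive_add (is_derive_add (is_derive_const t (1 : R) c)
    (is_derive_exp_affine L k (R1 ^+ 2) t)) (is_derive_const t (1 : R) c').
  by rewrite addr0 add0r.
have cont f (t a : R) : is_derive t (1 : R) f a -> continuous_at t f.
  by move=> [df _]; apply: differentiable_continuous; exact/derivable1_diffP.
have r20 : 0 < r ^+ 2 by rewrite exprn_gt0.
have H : V x <= g (sqd y x) * j (sqd y x).
  apply: (annulus_comparison (j := j) (g := g) V_usc V_touch (ltW r0) AO); last by rewrite rx ltW.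
  - move=> s /andP[rs _]; have s0 := lt_le_trans r20 rs.
    split; last by rewrite powR_gt0.
    + have -> : g = (fun t => g t + 0) by apply/funext => t; rewrite addr0.
      exact: cont (dg s 0).
    + exact: cont (is_derive1_powR _ s0).
  - move=> c' s c'0 /andP[rs _]; have s0 := lt_trans r20 rs.
    pose g1 t := k * (L * expR (k * (t - R1 ^+ 2))).
    pose j1 (t : R) := b / 2 * t `^ (b / 2 - 1).
    have dg1 : is_derive s (1 : R) g1 (k * g1 s).
      exact: (is_derive_scale k (is_derive_exp_affine L k (R1 ^+ 2) s)).
    have dj1 : is_derive s (1 : R) j1 (b / 2 * ((b / 2 - 1) * s `^ (b / 2 - 1 - 1))).
      exact: (is_derive_scale (b / 2) (is_derive1_powR (b / 2 - 1) s0)).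
    have dgc := dg s c'.
    exists (fun t => (g t + c') * j1 t + j t * g1 t).
    eexists; split; last first.
    + move=> [_ + _]; rewrite /j1 powRB ?(gt_eqF s0) ?implybT// powRr1 ?(ltW s0)// -/(j s).
      have -> : 2 * s * ((g s + c') * (b / 2 * (j s / s)) + j s * g1 s) =
        b * ((g s + c') * j s) + 2 * s * j s * g1 s.
        by field; rewrite gt_eqF.
      by rewrite gerDl leNgt !mulr_gt0 ?powR_gt0// expR_gt0.
    + exact: (is_derive_add (is_derive_mul dgc dj1)
        (is_derive_mul (is_derive1_powR (b / 2) s0) dg1)).
    + have : \forall t \near s, 0 < t by exact: lt_nbhsr.
      apply: filterS => t t0.
      exact: (is_derive_mul (dg t c') (is_derive1_powR (b / 2) t0)).
  - move=> z zr Oz; rewrite (le_trans (bd _ zr Oz))// /j sqr_powR_half ?(ltW r0)//.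
    by rewrite ler_wpM2r ?powR_ge0// lerDl mulr_ge0 ?expR_ge0// ltW.
  - move=> z zR Oz; rewrite /g subrr mulr0 expR0 mulr1 /j sqr_powR_half ?(ltW R10)//.
    have := KV z; rewrite /= zR lexx (le_trans rx (ltW xR)) => /(_ isT) Vz.
    have Rb0 : 0 < R1 `^ b by rewrite powR_gt0.
    rewrite -ler_pdivrMr// (@le_trans _ _ (`|K| / R1 `^ b))//.
      by rewrite ler_wpM2r ?invr_ge0 ?powR_ge0// (le_trans Vz)// ler_norm.
    have := ler_norm (- c); rewrite normrN /L; lra.
apply: le_trans H _; rewrite /j sqdE sqr_powR_half ?enorm_ge0//.
rewrite ler_wpM2r ?powR_ge0// /g lerD2l.
by rewrite -opprB.
Qed.

End ExtremalRadii.

(** * Chains on spheres *)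

Lemma powR_div (R : realType) (a c b : R) : 0 <= a -> 0 < c ->
  (a / c) `^ b = a `^ b / c `^ b.
Proof.
move=> a0 c0; rewrite powRM ?invr_ge0 ?(ltW c0)//.
by rewrite -(powR_inv1 (ltW c0)) -powRrM mulN1r powRN.
Qed.

(** Two coordinates suffice: exchange the first two with one sign change, or take the first
    coordinate vector if x_0 = 0. Applied to x = 0 it merely produces a point of the sphere. *)
Lemma orthogonal_on_sphere (R : realType) n (x : 'rV[R]_n.+2) (r : R) : 0 < r ->
  exists2 e, enorm e = r & \sum_(i < n.+2) x 0 i * e 0 i = 0.
Proof.
move=> r0; suff [w w0 xw] : exists2 w : 'rV[R]_n.+2, w != 0 &
    \sum_(i < n.+2) x 0 i * w 0 i = 0.
  have ew : enorm w != 0 by apply: contra w0 => /eqP/enorm_eq0 ->.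
  exists ((r / enorm w) *: w).
    by rewrite enormZ ger0_norm ?divfK// divr_ge0 ?enorm_ge0 ?ltW.
  rewrite (eq_bigr (fun i => r / enorm w * (x 0 i * w 0 i))).
    by rewrite -mulr_sumr xw mulr0.
  by move=> i _; rewrite mxE mulrCA.
have [x0|x0] := eqVneq (x 0 0) 0.
  exists (delta_mx 0 0).
    apply/eqP => /matrixP/(_ 0 0)/eqP; rewrite !mxE !eqxx/=.
    by rewrite oner_eq0.
  rewrite (bigD1 0)//= x0 mul0r add0r big1// => i /negbTE i0.
  by rewrite mxE i0 andbF mulr0.
exists (\row_i (if (i : nat) == 0%N then - x 0 1 else if (i : nat) == 1%N then x 0 0 else 0)).
  apply/eqP => /matrixP/(_ 0 1)/eqP; rewrite !mxE/=.
  by rewrite (negbTE x0).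
rewrite !big_ord_recl big1 => [|i _]; last by rewrite !mxE/= mulr0.
rewrite !mxE/= addr0.
have -> : lift ord0 ord0 = 1 :> 'I_n.+2 by apply/val_inj.
have -> : ord0 = 0 :> 'I_n.+2 by apply/val_inj.
by rewrite mulrN mulrC addNr.
Qed.

(** A nonnegative inner product gives |(1 - t) x + t y|^2 >= ((1 - t)^2 + t^2) r^2 >= r^2 / 2, so
    the chord stays away from the origin. *)
Lemma segment_enorm (R : realType) n (x y : 'rV[R]_n) (r t : R) :
  enorm x = r -> enorm y = r -> 0 <= \sum_(i < n) x 0 i * y 0 i -> 0 <= t <= 1 ->
  r / 2 <= enorm (x + t *: (y - x)) <= r.
Proof.
move=> xr yr xy /andP[t0 t1]; have r0 : 0 <= r by rewrite -xr enorm_ge0.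
have E : x + t *: (y - x) = (1 - t) *: x + t *: y.
  by rewrite scalerBr scalerBl scale1r [t *: y - _]addrC addrA.
apply/andP; split; last first.
  rewrite E (le_trans (ler_enormD _ _))// !enormZ xr yr !ger0_norm ?subr_ge0//.
  by rewrite -mulrDl subrK mul1r.
rewrite -(@ler_pXn2r _ 2)// ?nnegrE ?enorm_ge0 ?divr_ge0//.
rewrite E enormD_sqr !enormZ xr yr !exprMn !real_normK ?num_real//.
rewrite (eq_bigr (fun i => (1 - t) * t * (x 0 i * y 0 i))); last first.
  by move=> i _; rewrite !mxE; ring.
rewrite -mulr_sumr.
have t1' : 0 <= 1 - t by rewrite subr_ge0.
have H1 := mulr_ge0 (mulr_ge0 t1' t0) xy.
have H2 : (r / 2) ^+ 2 <= ((1 - t) ^+ 2 + t ^+ 2) * r ^+ 2.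
  rewrite exprMn mulrC ler_wpM2r ?sqr_ge0//.
  by have := sqr_ge0 (t - 2^-1); rewrite !expr2; lra.
rewrite mulrDl in H2; lra.
Qed.

Section SphereChain.
Variables (R : realType) (n : nat) (r d : R) (D : nat) (Q : nat -> 'rV[R]_n -> Prop).
Hypotheses (D_gt0 : (0 < D)%N) (Dd : 2 * r <= D%:R * d).
Hypothesis step : forall k p q, r / 2 <= enorm p <= r -> r / 2 <= enorm q <= r ->
  enorm (q - p) <= d -> Q k p -> Q k.+1 q.

(** A chord has length at most 2 r, hence D equal steps have length at most d. The counter in [Q]
    lets the propagated property weaken from step to step. *)
Lemma segment_chain k (x y : 'rV[R]_n) :
  enorm x = r -> enorm y = r -> 0 <= \sum_(i < n) x 0 i * y 0 i ->
  Q k x -> Q (k + D) y.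
Proof.
move=> xr yr xy Qx.
pose p j : 'rV[R]_n := x + (j%:R / D%:R) *: (y - x).
have D0 : 0 < D%:R :> R by rewrite ltr0n.
have pr j : (j <= D)%N -> r / 2 <= enorm (p j) <= r.
  move=> jD; apply: segment_enorm => //.
  by rewrite divr_ge0//= ler_pdivrMr// mul1r ler_nat.
have H j : (j <= D)%N -> Q (k + j)%N (p j).
  elim: j => [_|j IH jD]; first by rewrite addn0 /p mul0r scale0r addr0.
  rewrite addnS; apply: step (IH (ltnW jD)); [exact/pr/ltnW|exact: pr|].
  have -> : p j.+1 - p j = D%:R^-1 *: (y - x).
    rewrite /p opprD addrACA subrr add0r -scalerBl; congr (_ *: _).
    by rewrite -mulrBl -natrB// subSnn mul1r.
  rewrite enormZ ger0_norm ?invr_ge0 ?(ltW D0)// mulrC ler_pdivrMr//.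
  rewrite mulrC; apply: le_trans Dd; rewrite (le_trans (ler_enormD _ _))//.
  by rewrite enormN xr yr; lra.
by have := H D (leqnn D); rewrite /p divff ?gt_eqF// scale1r addrC subrK.
Qed.

End SphereChain.

(* Two points of a sphere are joined through a third point e of the sphere which is
   orthogonal to one of them and makes a nonobtuse angle with the other, so that
   the chain stays away from the origin. *)
Lemma sphere_chain (R : realType) n (r d : R) (D : nat) (Q : nat -> 'rV[R]_n.+2 -> Prop) :
  0 < r -> (0 < D)%N -> 2 * r <= D%:R * d ->
  (forall k p q, r / 2 <= enorm p <= r -> r / 2 <= enorm q <= r ->
    enorm (q - p) <= d -> Q k p -> Q k.+1 q) ->
  forall x y, enorm x = r -> enorm y = r -> Q 0%N x -> Q (D + D)%N y.
Proof.
move=> r0 D0 Dd step x y xr yr Qx.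
have [e er ye] : exists2 e, enorm e = r &
    \sum_(i < n.+2) y 0 i * e 0 i = 0 /\ 0 <= \sum_(i < n.+2) x 0 i * e 0 i.
  have [e er ye] := orthogonal_on_sphere y r0.
  have [xe|xe] := leP 0 (\sum_(i < n.+2) x 0 i * e 0 i); first by exists e.
  exists (- e); first by rewrite enormN.
  split.
    by under eq_bigr do rewrite mxE mulrN; rewrite sumrN ye oppr0.
  by under eq_bigr do rewrite mxE mulrN; rewrite sumrN oppr_ge0 ltW.
have Qe := segment_chain D0 Dd step xr er ye.2 Qx.
rewrite add0n in Qe; apply: (segment_chain D0 Dd step er yr _ Qe).
by under eq_bigr do rewrite mulrC; rewrite ye.1.
Qed.

(** * Behaviour near the origin *)

Definition punctured_ball (R : realType) n : set 'rV[R]_n :=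
  [set x | 0 < enorm x < 1].

Section PuncturedBall.
Variables (R : realType) (n : nat) (b : R) (V : 'rV[R]_n.+2 -> R).
Local Notation P := (@punctured_ball R n.+2).
Hypotheses (b_gt0 : 0 < b) (b_le1 : b <= 1)
  (V_gt0 : forall x, P x -> 0 < V x)
  (V_usc : usc_in P V) (V_touch : radial_touching b P V).
Implicit Types x y : 'rV[R]_n.+2.

Lemma ball_comparison y (R1 M : R) : 0 < R1 ->
  (forall x, enorm (x - y) <= R1 -> P x) ->
  (forall x, enorm (x - y) <= R1 -> V x <= M) ->
  forall x, enorm (x - y) <= R1 -> V x <= V y + (M - V y) * (enorm (x - y) / R1) `^ b.
Proof.
move=> R10 BP BM x xR.
have yR : enorm (y - y) <= R1 by rewrite subrr enorm0 ltW.
have [x0|x0] := ltP 0 (enorm (x - y)); last first.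
  have /enorm_eq0/eqP : enorm (x - y) = 0 by apply/le_anti; rewrite x0 enorm_ge0.
  by rewrite subr_eq0 => /eqP ->; rewrite lerDl mulr_ge0 ?powR_ge0// subr_ge0 BM.
apply: (radial_comparison b_le1 V_usc V_touch R10) => //.
- exact: BM.
- by move=> z /andP[_]; exact: BP.
- move=> e e0; have [|d d0 dP] := V_usc (a := V y + e) (BP _ yR); first by rewrite ltrDl.
  by exists d.
- by move=> z zR _; apply: BM; rewrite zR.
- by rewrite x0.
Qed.

Definition sphere_sup (r : R) : R := sup [set V x | x in [set x | enorm x = r]].

Lemma punctured_ballE r x : 0 < r < 1 -> enorm x = r -> P x.
Proof. by move=> r01 xr; rewrite /punctured_ball/= xr. Qed.

Lemma sphere_supP r : 0 < r < 1 ->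
  (exists2 x, enorm x = r & V x = sphere_sup r) /\
  forall x, enorm x = r -> V x <= sphere_sup r.
Proof.
move=> /andP[r0 r1].
have [e er _] := orthogonal_on_sphere (0 : 'rV[R]_n.+2) r0.
have sphE (z : 'rV[R]_n.+2) : (r <= enorm (z - 0) <= r) <-> enorm z = r.
  by rewrite subr0; split=> [/le_anti ->//|->]; rewrite lexx.
have sP : [set z : 'rV[R]_n.+2 | r <= enorm (z - 0) <= r] `<=` P.
  by move=> z /= /sphE zr; apply: punctured_ballE zr; rewrite r0.
have L := lsc_in_sub_mul (usc_in_sub sP V_usc) (fun x _ => ler01 : 0 <= (fun=> 1 : R) x)
  (fun x _ => @cst_continuous _ _ (0 : R) x) (fun x _ => @cst_continuous _ _ (1 : R) x).
have [x /sphE xr xmin] := lsc_in_min (@compact_annulus R n.+2 0 r r)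
  (ex_intro _ e ((sphE e).2 er)) L.
have xmax z : enorm z = r -> V z <= V x.
  by move=> /sphE/xmin; rewrite /= !mul1r; lra.
have ub : ubound [set V x | x in [set x | enorm x = r]] (V x).
  by move=> _ [z zr <-]; exact: xmax.
have hs : has_sup [set V x | x in [set x | enorm x = r]].
  by split; [exists (V x), x|exists (V x)].
have xS : V x = sphere_sup r.
  apply/le_anti/andP; split; first by apply: ub_le_sup; [exact: hs.2|exists x].
  by apply: ge_sup; [exact: hs.1|exact: ub].
by split; [exists x|move=> z /xmax; rewrite xS].
Qed.

Lemma sphere_sup_gt0 r : 0 < r < 1 -> 0 < sphere_sup r.
Proof.
move=> r01; have [[x xr <-] _] := sphere_supP r01.
exact/V_gt0/(punctured_ballE r01).
Qed.

Lemma le_sphere_sup r x : 0 < enorm x <= r -> r < 1 -> V x <= sphere_sup r.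
Proof.
move=> /andP[x0 xr] r1; have r01 : 0 < r < 1 by rewrite r1 (lt_le_trans x0).
apply: (outer_sphere_max (y := 0) (R1 := r) V_usc V_touch).
- by move=> z; rewrite subr0 /punctured_ball/= => /andP[-> /le_lt_trans ->].
- by move=> z; rewrite subr0 => zr _; exact: (sphere_supP r01).2.
- by rewrite subr0 x0.
Qed.

(** By [le_sphere_sup] the sphere maxima are nondecreasing in r, so this infimum is their limit at
    the origin. *)
Definition center_value : R := inf [set sphere_sup r | r in [set r | 0 < r < 1]].

Let S := [set sphere_sup r | r in [set r | 0 < r < 1]].

Let half01 : 0 < (2^-1 : R) < 1.
Proof. by rewrite invr_gt0 ltr0n invf_lt1 ?ltr1n. Qed.

Let has_inf_S : has_inf S.
Proof.
split; first by exists (sphere_sup 2^-1), 2^-1.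
by exists 0 => _ [r r01 <-]; exact/ltW/sphere_sup_gt0.
Qed.

Lemma center_value_ge0 : 0 <= center_value.
Proof.
apply: lb_le_inf; first exact: has_inf_S.1.
by move=> _ [r r01 <-]; exact/ltW/sphere_sup_gt0.
Qed.

Lemma center_value_le r : 0 < r < 1 -> center_value <= sphere_sup r.
Proof. by move=> r01; apply: ge_inf; [exact: has_inf_S.2|exists r]. Qed.

Lemma center_value_upper r x : 0 < enorm x <= r -> r < 1 ->
  V x <= center_value + (sphere_sup r - center_value) * (enorm x / r) `^ b.
Proof.
move=> /andP[x0 xr] r1; have r01 : 0 < r < 1 by rewrite r1 (lt_le_trans x0).
have [r0 _] := andP r01.
have := @radial_comparison _ _ b P V b_le1 V_usc V_touch 0 r center_value (sphere_sup r).
move=> /(_ r0 (center_value_le r01)); rewrite -{2}[x]subr0; apply.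
- by move=> z; rewrite subr0 /punctured_ball/= => /andP[-> /le_lt_trans ->].
- move=> e e0; have [_ [s /andP[s0 s1] <-] se] := inf_adherent e0 has_inf_S.
  exists s => // z Pz; rewrite subr0 => zs; apply: le_lt_trans se.
  by apply: le_sphere_sup => //; have /andP[-> _] := Pz; rewrite ltW.
- by move=> z; rewrite subr0 => zr _; exact: (sphere_supP r01).2.
- by rewrite subr0 x0.
Qed.

(** A sphere of radius r is crossed along two chords of 16 steps each. A step has length r / 8, half
    the radius of a comparison ball, and costs the factor 1 - 2^(-b). *)
Definition harnack_cst : R := (1 - 2^-1 `^ b) ^+ 32.

Let c0 : R := 1 - 2^-1 `^ b.

Let c0_gt0 : 0 < c0.
Proof.
rewrite subr_gt0; have : 2^-1 `^ b < 1 `^ b.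
  by rewrite gt0_ltr_powR// ?nnegrE ?invr_ge0//; have /andP[] := half01.
by rewrite powR1.
Qed.

Lemma harnack_cst_gt0 : 0 < harnack_cst.
Proof. exact: exprn_gt0. Qed.

Lemma harnack_cst_le1 : harnack_cst <= 1.
Proof. by rewrite exprn_ile1 ?(ltW c0_gt0)// gerBl powR_ge0. Qed.

Lemma sphere_harnack r x y : 0 < r -> 2 * r < 1 -> enorm x = r -> enorm y = r ->
  harnack_cst * (sphere_sup (2 * r) - V x) <= sphere_sup (2 * r) - V y.
Proof.
move=> r0 r1 xr yr; pose K := sphere_sup (2 * r).
pose Q (k : nat) p := c0 ^+ k * (K - V x) <= K - V p.
suff : Q (16 + 16)%N y by [].
(* For r / 2 <= |p| <= r the ball of radius r / 4 around p avoids the origin and lies in |z| <= 2 r,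
   where V <= K. *)
apply: (@sphere_chain R n r (r / 8) 16 Q) xr yr _ => //; first by lra.
  move=> k p q /andP[p1 p2] /andP[q1 q2] qp; rewrite /Q => Qp.
  have r4 : 0 < r / 4 by rewrite divr_gt0.
  have near_p z : enorm (z - p) <= r / 4 -> 0 < enorm z <= 2 * r.
    move=> zp; have := enorm_triangle0 z p; have := enorm_triangle0 p z.
    by rewrite (enorm_distC p z); lra.
  have BK z : enorm (z - p) <= r / 4 -> V z <= K.
    by move=> /near_p z2; exact: le_sphere_sup.
  have BP z : enorm (z - p) <= r / 4 -> P z.
    by move=> /near_p/andP[z1 z2]; rewrite /punctured_ball/= z1 (le_lt_trans z2).
  have pK : 0 <= K - V p by rewrite subr_ge0 BK// subrr enorm0 ltW.
  have qp4 : enorm (q - p) <= r / 4 by lra.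
  have := ball_comparison r4 BP BK qp4.
  have : (enorm (q - p) / (r / 4)) `^ b <= 2^-1 `^ b.
    apply: ge0_ler_powR; rewrite ?nnegrE ?divr_ge0 ?enorm_ge0 ?(ltW r0) ?(ltW b_gt0)//.
    by rewrite ler_pdivrMr//; lra.
  move=> /(ler_wpM2l pK) H1 H2; rewrite exprS -mulrA.
  apply: le_trans (ler_wpM2l (ltW c0_gt0) Qp) _.
  by rewrite /c0; lra.
by rewrite /Q expr0 mul1r.
Qed.

Definition center_cst (r : R) : R := (2 / r) `^ b / harnack_cst.

(** The lower bound comes from the Harnack inequality on the sphere through x: at its maximum point
    V >= v0, so S(2|x|) - V is there at most S(2|x|) - v0 <= S(r) (2|x|/r)^b, and at x at most this
    over the Harnack constant. For 2|x| > r the right-hand side is already at least S(r). *)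
Lemma center_holder r x : 0 < enorm x <= r -> r < 1 ->
  `|V x - center_value| <= center_cst r * sphere_sup r * enorm x `^ b.
Proof.
move=> /andP[x0 xr] r1; have r0 := lt_le_trans x0 xr.
have r01 : 0 < r < 1 by rewrite r0.
have S0 := sphere_sup_gt0 r01; have cS := center_value_le r01; have c_ge0 := center_value_ge0.
have h0 := harnack_cst_gt0; have h1 := harnack_cst_le1.
have -> : center_cst r * sphere_sup r * enorm x `^ b =
    harnack_cst^-1 * (sphere_sup r * (2 * enorm x / r) `^ b).
  rewrite [2 * _ / r]mulrAC powRM ?enorm_ge0 ?divr_ge0 ?(ltW r0)// /center_cst; ring.
set E := (2 * enorm x / r) `^ b.
have E0 : 0 <= E by rewrite powR_ge0.
have SE0 : 0 <= sphere_sup r * E by rewrite mulr_ge0// ltW.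
have SE : sphere_sup r * E <= harnack_cst^-1 * (sphere_sup r * E).
  by rewrite ler_peMl// invf_ge1.
have le2 : (enorm x / r) `^ b <= E.
  apply: ge0_ler_powR; rewrite ?nnegrE ?divr_ge0 ?mulr_ge0 ?(ltW r0) ?(ltW x0) ?(ltW b_gt0)//.
  by rewrite ler_pM2r ?invr_gt0//; lra.
rewrite ler_norml; apply/andP; split; last first.
  rewrite lerBlDl; apply: le_trans (center_value_upper _ r1) _; first by rewrite x0.
  rewrite lerD2l; apply: le_trans SE; apply: ler_pM => //; rewrite ?powR_ge0 ?subr_ge0//.
  by rewrite gerBl.
have [x2|x2] := leP (2 * enorm x) r; last first.
  have : 1 <= E.
    have <- : 1 `^ b = 1 by rewrite powR1.
    apply: ge0_ler_powR; rewrite ?nnegrE ?divr_ge0 ?mulr_ge0 ?(ltW r0) ?(ltW x0) ?(ltW b_gt0)//.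
    by rewrite ler_pdivlMr// mul1r ltW.
  move=> /(ler_wpM2l (ltW S0)); rewrite mulr1.
  have x01 : P x by rewrite /punctured_ball/= x0 (le_lt_trans xr).
  by have := V_gt0 x01; lra.
have x21 : 2 * enorm x < 1 by exact: le_lt_trans x2 r1.
have x01 : 0 < enorm x < 1 by rewrite x0 (le_lt_trans xr).
have [[z zx Vz] _] := sphere_supP x01.
have := sphere_harnack x0 x21 (erefl _) zx; rewrite Vz => H.
have x201 : 0 < 2 * enorm x < 1 by rewrite x21 mulr_gt0.
have [[w wx Vw] _] := sphere_supP x201.
have := center_value_upper (x := w) (r := r); rewrite wx x2 mulr_gt0// Vw => /(_ isT r1).
rewrite -/E => Hw.
have Hc := center_value_le x01.
have Hc2 := center_value_le x201.
have SEc : (sphere_sup r - center_value) * E <= sphere_sup r * E.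
  by rewrite ler_wpM2r// gerBl.
have : sphere_sup (2 * enorm x) - V x <= harnack_cst^-1 * (sphere_sup r * E).
  by rewrite ler_pdivlMl//; lra.
lra.
Qed.

End PuncturedBall.

(** * Hoelder regularity up to the origin, and homogeneity when v0 = 0 *)

Section HolderAtOrigin.
Variables (R : realType) (n : nat) (b : R) (V : 'rV[R]_n.+2 -> R).
Local Notation P := (@punctured_ball R n.+2).
Hypotheses (b_gt0 : 0 < b) (b_le1 : b <= 1)
  (V_gt0 : forall x, P x -> 0 < V x)
  (V_usc : usc_in P V) (V_touch : radial_touching b P V).
Implicit Types x y : 'rV[R]_n.+2.
Local Notation S := (sphere_sup V).
Local Notation v0 := (center_value V).

(** The minimum is the ratio k of |x - y| to |y| that separates the two cases of [punctured_holder];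
    the leading 2 accounts for two distances to v0. *)
Definition holder_cst (r r' : R) : R :=
  2 * center_cst b r' * (2 / Num.min 2^-1 (r' - r)) `^ b.

Lemma center_cst_gt0 r : 0 < r -> 0 < center_cst b r.
Proof. by move=> r0; rewrite divr_gt0 ?harnack_cst_gt0// powR_gt0// divr_gt0. Qed.

Lemma ler_powR_gt0 (s t : R) : 0 <= s -> s <= t -> s `^ b <= t `^ b.
Proof.
by move=> s0 st; apply: ge0_ler_powR; rewrite ?nnegrE ?(ltW b_gt0)// (le_trans s0).
Qed.

Lemma center_le_holder_cst r r' : 0 < r -> r < r' -> center_cst b r' <= holder_cst r r'.
Proof.
move=> r0 rr'; have r'0 := lt_trans r0 rr'.
pose k := Num.min 2^-1 (r' - r).
have k0 : 0 < k by rewrite lt_min invr_gt0 ltr0n subr_gt0.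
have k1 : k <= 2^-1 by rewrite ge_min lexx.
have : 1 `^ b <= (2 / k) `^ b by rewrite ler_powR_gt0// ler_pdivlMr//; lra.
rewrite powR1 => H; have C0 := center_cst_gt0 r'0.
by rewrite /holder_cst -/k mulrAC ler_peMl ?(ltW C0)//; lra.
Qed.

(** If |x - y| <= k |y|, compare in the ball of radius k |y| around y: k <= 1/2 keeps it off the
    origin, k <= r' - r keeps it inside radius r', and V exceeds V y there by at most a multiple of
    |y|^b. Otherwise |x| and |y| are at most 2 |x - y| / k, and both values are compared with v0. *)
Lemma punctured_holder r r' x y : r < r' -> r' < 1 ->
  0 < enorm x <= r -> 0 < enorm y <= r ->
  V x - V y <= holder_cst r r' * S r' * enorm (x - y) `^ b.
Proof.
move=> rr' r'1 /andP[x0 xr] /andP[y0 yr].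
have r0 := lt_le_trans x0 xr; have r'0 := lt_trans r0 rr'.
pose k := Num.min 2^-1 (r' - r); rewrite /holder_cst -/k.
have k0 : 0 < k by rewrite lt_min invr_gt0 ltr0n subr_gt0.
have k1 : k <= 2^-1 by rewrite ge_min lexx.
have k2 : k <= r' - r by rewrite ge_min lexx orbT.
have S0 : 0 < S r' by apply: (sphere_sup_gt0 V_gt0 V_usc); rewrite r'0.
set C := center_cst b r'; have C0 : 0 < C by exact: center_cst_gt0.
have CS0 : 0 < C * S r' by rewrite mulr_gt0.
have CV z : 0 < enorm z <= r' -> `|V z - v0| <= C * S r' * enorm z `^ b.
  by move=> zr'; exact: (center_holder b_gt0 b_le1 V_gt0 V_usc V_touch).
have y0r : 0 < enorm y <= r' by rewrite y0 (le_trans yr)// ltW.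
have x0r : 0 < enorm x <= r' by rewrite x0 (le_trans xr)// ltW.
have [xy|xy] := leP (enorm (x - y)) (k * enorm y).
  pose R1 := k * enorm y; have R10 : 0 < R1 by rewrite mulr_gt0.
  have R1y : R1 <= enorm y / 2 by rewrite /R1 mulrC ler_pM2l.
  have R1r : R1 <= r' - r.
    by apply: le_trans k2; rewrite /R1 ler_piMr ?(ltW k0)//; lra.
  have nz z : enorm (z - y) <= R1 -> [/\ 0 < enorm z, enorm z <= r' & enorm z <= 2 * enorm y].
    move=> zy; have := enorm_triangle0 z y; have := enorm_triangle0 y z.
    by rewrite (enorm_distC y z); split; lra.
  have BP z : enorm (z - y) <= R1 -> P z.
    by move=> /nz[z0 zr' _]; rewrite /punctured_ball/= z0 (le_lt_trans zr').
  pose M := v0 + C * S r' * (2 * enorm y) `^ b.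
  have BM z : enorm (z - y) <= R1 -> V z <= M.
    move=> /nz[z0 zr' z2]; have := CV z; rewrite z0 zr' => /(_ isT).
    rewrite ler_norml => /andP[_]; rewrite lerBlDl => /le_trans; apply.
    by rewrite lerD2l ler_pM2l// ler_powR_gt0// ltW.
  have := ball_comparison b_le1 V_usc V_touch R10 BP BM xy.
  have My : M - V y <= 2 * (C * S r' * (2 * enorm y) `^ b).
    have := CV y y0r; rewrite ler_norml => /andP[Hy _].
    have : C * S r' * enorm y `^ b <= C * S r' * (2 * enorm y) `^ b.
      by rewrite ler_pM2l// ler_powR_gt0 ?(ltW y0)//; lra.
    by rewrite /M; lra.
  have := ler_wpM2r (powR_ge0 (enorm (x - y) / R1) b) My.
  have -> : 2 * (C * S r' * (2 * enorm y) `^ b) * (enorm (x - y) / R1) `^ b =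
      2 * C * (2 / k) `^ b * S r' * enorm (x - y) `^ b.
    rewrite /R1 !powR_div ?enorm_ge0// !powRM ?(ltW k0) ?(ltW y0)//.
    by field; rewrite !gt_eqF// powR_gt0.
  lra.
have yk : enorm y <= 2 / k * enorm (x - y).
  rewrite mulrAC ler_pdivlMr// mulrC; apply: le_trans (ltW xy) _.
  by rewrite ler_peMl ?enorm_ge0//; lra.
have xk : enorm x <= 2 / k * enorm (x - y).
  rewrite mulrAC ler_pdivlMr//.
  have := enorm_triangle0 x y => /(ler_wpM2r (ltW k0)).
  have : enorm (x - y) * k <= enorm (x - y) by rewrite ler_piMr ?enorm_ge0//; lra.
  by rewrite mulrDl [enorm y * k]mulrC; lra.
have -> : 2 * C * (2 / k) `^ b * S r' * enorm (x - y) `^ b =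
    C * S r' * (2 / k * enorm (x - y)) `^ b + C * S r' * (2 / k * enorm (x - y)) `^ b.
  by rewrite (@powRM _ (2 / k)) ?enorm_ge0 ?divr_ge0 ?(ltW k0)//; ring.
have := CV x x0r; rewrite ler_norml => /andP[_ Hx].
have := CV y y0r; rewrite ler_norml => /andP[Hy _].
have : C * S r' * enorm x `^ b <= C * S r' * (2 / k * enorm (x - y)) `^ b.
  by rewrite ler_pM2l// ler_powR_gt0// ltW.
have : C * S r' * enorm y `^ b <= C * S r' * (2 / k * enorm (x - y)) `^ b.
  by rewrite ler_pM2l// ler_powR_gt0// ltW.
lra.
Qed.

Definition extension x : R := if x == 0 then v0 else V x.

Lemma extension_holder r r' x y : 0 < r -> r < r' -> r' < 1 ->
  enorm x <= r -> enorm y <= r ->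
  `|extension x - extension y| <= holder_cst r r' * S r' * enorm (x - y) `^ b.
Proof.
move=> r0 rr' r'1 xr yr; have r'0 := lt_trans r0 rr'.
have S0 : 0 < S r' by apply: (sphere_sup_gt0 V_gt0 V_usc); rewrite r'0.
have H0 z : z != 0 -> enorm z <= r -> `|V z - v0| <= holder_cst r r' * S r' * enorm z `^ b.
  rewrite -enorm_gt0 => z0 zr.
  apply: le_trans (center_holder b_gt0 b_le1 V_gt0 V_usc V_touch (r := r') _ r'1) _.
    by rewrite z0 (le_trans zr)// ltW.
  by rewrite ler_wpM2r ?powR_ge0// ler_wpM2r ?(ltW S0)// center_le_holder_cst.
rewrite /extension; have [->|x0] := eqVneq x 0; have [->|y0] := eqVneq y 0.
- rewrite subrr normr0.
  have h0 := le_trans (ltW (center_cst_gt0 r'0)) (center_le_holder_cst r0 rr').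
  exact: mulr_ge0 (mulr_ge0 h0 (ltW S0)) (powR_ge0 _ _).
- by rewrite distrC sub0r enormN; exact: H0.
- by rewrite subr0; exact: H0.
- rewrite -enorm_gt0 in x0; rewrite -enorm_gt0 in y0.
  rewrite ler_norml; apply/andP; split.
    rewrite lerNl opprB enorm_distC; apply: punctured_holder => //; by rewrite ?x0 ?y0.
  by apply: punctured_holder => //; rewrite ?x0 ?y0.
Qed.

Lemma sphere_sup_homogeneous r s : v0 = 0 -> 0 < r < 1 -> 0 < s < 1 ->
  S r = S s * (r / s) `^ b.
Proof.
move=> v00.
have up p q : 0 < p -> p <= q -> q < 1 -> S p <= S q * (p / q) `^ b.
  move=> p0 pq q1; have p01 : 0 < p < 1 by rewrite p0 (le_lt_trans pq).
  have [[x xp <-] _] := sphere_supP V_usc p01.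
  have := center_value_upper b_le1 V_gt0 V_usc V_touch (x := x) (r := q).
  by rewrite xp p0 pq v00 add0r subr0 => /(_ isT q1).
have low p q : 0 < p -> p <= q -> q < 1 -> S q <= S p * (q / p) `^ b.
  move=> p0 pq q1; have p01 : 0 < p < 1 by rewrite p0 (le_lt_trans pq).
  have q0 := lt_le_trans p0 pq; have q01 : 0 < q < 1 by rewrite q0.
  have [[x xq <-] _] := sphere_supP V_usc q01.
  (* Any outer radius strictly between q and 1 serves, since no bound is required on that sphere. *)
  have := @inner_sphere_max R n.+1 b P V V_usc V_touch 0 p ((1 + q) / 2) (S p / p `^ b) p0.
  have qh : q < (1 + q) / 2 by lra.
  have -> : S p * (q / p) `^ b = S p / p `^ b * enorm (x - 0) `^ b.
    by rewrite subr0 xq powR_div ?(ltW q0)//; ring.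
  apply.
  - move=> z; rewrite subr0 /punctured_ball/= => /andP[z1 z2].
    by rewrite (lt_le_trans p0 z1) (le_lt_trans z2)//; lra.
  - move=> z; rewrite subr0 divfK ?gt_eqF ?powR_gt0// => zp _.
    exact: (sphere_supP V_usc p01).2.
  - by rewrite subr0 xq pq.
move=> /andP[r0 r1] /andP[s0 s1].
have inv p q : 0 < p -> 0 < q -> (p / q) `^ b * (q / p) `^ b = 1.
  move=> p0 q0; rewrite -powRM ?divr_ge0 ?(ltW p0) ?(ltW q0)//.
  have -> : p / q * (q / p) = 1 by field; rewrite !gt_eqF.
  by rewrite powR1.
apply/le_anti/andP; split.
  have [rs|/ltW sr] := leP r s; [exact: up|exact: low].
have [rs|/ltW sr] := leP r s.
  have := ler_wpM2r (powR_ge0 (r / s) b) (low _ _ r0 rs s1).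
  by rewrite -mulrA inv// mulr1.
have := ler_wpM2r (powR_ge0 (r / s) b) (up _ _ s0 sr r1).
by rewrite -mulrA inv// mulr1.
Qed.

End HolderAtOrigin.

(** * Strong minimum principle *)

Definition laplace_touching (R : realType) n (O : set 'rV[R]_n) (u : 'rV[R]_n -> R) :=
  forall (y z : 'rV[R]_n) (F F1 : R -> R) F2 (K K1 : R -> R) K2 x,
  O x -> u x = F (sqd y x) + K (sqd z x) ->
  (\forall w \near x, F (sqd y w) + K (sqd z w) <= u w) ->
  (\forall t \near sqd y x, is_derive (t : R) (1 : R) F (F1 t)) ->
  is_derive (sqd y x) (1 : R) F1 F2 ->
  (\forall t \near sqd z x, is_derive (t : R) (1 : R) K (K1 t)) ->
  is_derive (sqd z x) (1 : R) K1 K2 ->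
  2 * n%:R * F1 (sqd y x) + 4 * sqd y x * F2 +
  (2 * n%:R * K1 (sqd z x) + 4 * sqd z x * K2) <= 0.

Lemma lsc_in_add (R : realType) n (A B : set 'rV[R]_n) (u g : 'rV[R]_n -> R) :
  B `<=` A -> lsc_in A u -> (forall x, B x -> continuous_at x g) ->
  lsc_in B (fun x => g x + u x).
Proof.
move=> BA lu cg.
have uN : usc_in B (fun x => - u x).
  move=> x a Bx; rewrite ltrNl => ax; have [d d0 dP] := lu _ _ (BA _ Bx) ax.
  by exists d => // z Bz zx; rewrite ltrNl; apply: dP => //; exact: BA.
have := lsc_in_sub_mul uN (fun x _ => ler01 : 0 <= (fun=> 1 : R) x) cg
  (fun x _ => @cst_continuous _ _ (1 : R) x).
have -> // : (fun x => g x - 1 * - u x) = (fun x => g x + u x).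
by apply/funext => x; rewrite mul1r opprK.
Qed.

Section StrongMinimumPrinciple.
Variables (R : realType) (n : nat) (u : 'rV[R]_n.+2 -> R) (C : R).
Local Notation P := (@punctured_ball R n.+2).
Hypotheses (u_lsc : lsc_in P u) (u_touch : laplace_touching P u).
Implicit Types x y p q : 'rV[R]_n.+2.

(** In dimension n + 2 this is C |x|^(2 - dim), a multiple of the fundamental solution, as a
    function of s = |x|^2. *)
Definition fund (s : R) : R := C * s `^ (- (n%:R / 2)).

Let m : R := n.+2%:R.

Let fund1 (s : R) := C * (- (n%:R / 2) * s `^ (- (n%:R / 2) - 1)).

Let fund2 (s : R) :=
  C * (- (n%:R / 2) * ((- (n%:R / 2) - 1) * s `^ (- (n%:R / 2) - 1 - 1))).

Let is_derive_fund (s : R) : 0 < s -> is_derive s (1 : R) fund (fund1 s).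
Proof. by move=> s0; exact: (is_derive_scale C (is_derive1_powR _ s0)). Qed.

Let is_derive_fund1 (s : R) : 0 < s -> is_derive s (1 : R) fund1 (fund2 s).
Proof.
by move=> s0; exact: (is_derive_scale C (is_derive_scale _ (is_derive1_powR _ s0))).
Qed.

Let fund_harmonic (s : R) : 0 < s -> 2 * m * fund1 s + 4 * s * fund2 s = 0.
Proof.
move=> s0; rewrite /fund1 /fund2.
rewrite [s `^ (_ - 1 - 1)]powRB ?(gt_eqF s0) ?implybT// powRr1 ?(ltW s0)//.
have -> : m = n%:R + 2 by rewrite /m -addn2 natrD.
by field; rewrite gt_eqF.
Qed.

Let continuous_at_is_derive (f : R -> R) (t a : R) :
  is_derive t (1 : R) f a -> continuous_at t f.
Proof.
by move=> [df _]; apply: differentiable_continuous; exact/derivable1_diffP.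
Qed.

Lemma sqd0_gt0 x : P x -> 0 < sqd 0 x.
Proof. by move=> /andP[x0 _]; rewrite sqdE subr0 exprn_gt0. Qed.

Lemma continuous_fund x : P x -> continuous_at x (fun z => fund (sqd 0 z)).
Proof.
move=> Px; apply: (@continuous_comp _ _ _ (sqd 0) fund); first exact: continuous_sqd.
exact: continuous_at_is_derive (is_derive_fund (sqd0_gt0 Px)).
Qed.

(** Strict inequality spreads from the centre p to the whole ball. The barrier [K 0] is strictly
    subharmonic on an annulus around p, at most e on the small inner sphere, where u - fund > e by
    semicontinuity, and zero on the outer one. So u - fund stays above it, and it is positive at
    q. *)
Lemma hopf_step p q (R1 : R) : (forall x, P x -> fund (sqd 0 x) <= u x) ->
  (forall x, enorm (x - p) <= R1 -> P x) -> enorm (q - p) < R1 ->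
  fund (sqd 0 p) < u p -> fund (sqd 0 q) < u q.
Proof.
move=> fu BP qR pu.
have R10 : 0 < R1 by rewrite (le_lt_trans _ qR)// enorm_ge0.
have Pp : P p by apply: BP; rewrite subrr enorm0 ltW.
have [e e0 eu] : exists2 e, 0 < e & e < u p - fund (sqd 0 p).
  by exists ((u p - fund (sqd 0 p)) / 2); lra.
have cN x : P x -> continuous_at x (fun z => 0 - fund (sqd 0 z)).
  by move=> Px; apply: continuous_at_sub; [exact: cst_continuous|exact: continuous_fund].
have L0 : lsc_in P (fun x => (0 - fund (sqd 0 x)) + u x)
  by exact: (lsc_in_add (@subset_refl _ P) u_lsc cN).
have [|d d0 dP] := L0 p e Pp; first by lra.
have [qd|dq] := ltP (enorm (q - p)) d.
  have Pq : P q by apply/BP/ltW.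
  by have := dP q Pq qd; lra.
pose r := d / 2; have r0 : 0 < r by rewrite divr_gt0.
(* With s = |x - p|^2, the Laplacian of exp(-k s) has the sign of 4 k s - 2 m, and k s >= m for s >=
   r^2. *)
pose k := m / r ^+ 2; have m0 : 0 < m by rewrite ltr0n.
have k0 : 0 < k by rewrite divr_gt0// exprn_gt0.
(* c is a vertical shift: a negative minimum of u - fund - K 0 is the c for which fund + K c touches
   u from below. *)
pose K c t := e * expR (- k * (t - 0)) + (c - e * expR (- k * (R1 ^+ 2 - 0))).
pose K1 t := - k * (e * expR (- k * (t - 0))).
have dK c t : is_derive t (1 : R) (K c) (K1 t).
  have := is_derive_add (is_derive_exp_affine e (- k) 0 t)
    (is_derive_const t (1 : R) (c - e * expR (- k * (R1 ^+ 2 - 0)))).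
  by rewrite addr0.
have dK1 t : is_derive t (1 : R) K1 (- k * K1 t).
  exact: (is_derive_scale (- k) (is_derive_exp_affine e (- k) 0 t)).
pose A := [set x : 'rV[R]_n.+2 | r <= enorm (x - p) <= R1].
have AP : A `<=` P by move=> x /andP[_]; exact: BP.
have L : lsc_in A (fun x => (0 - fund (sqd 0 x) - K 0 (sqd p x)) + u x).
  apply: (lsc_in_add AP u_lsc) => x Ax.
  apply: continuous_at_sub; first exact/cN/AP.
  apply: (@continuous_comp _ _ _ (sqd p) (K 0)); first exact: continuous_sqd.
  exact: continuous_at_is_derive (dK 0 _).
have Aq : A q by rewrite /A/= (ltW qR) andbT (le_trans _ dq)// /r; lra.
have [x Ax xmin] := lsc_in_min (@compact_annulus R n.+2 p r R1) (ex_intro _ q Aq) L.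
have Px := AP _ Ax.
have Kle t : 0 <= t -> K 0 t <= e.
  move=> t0; rewrite /K sub0r -[leRHS]addr0 lerD ?oppr_le0 ?mulr_ge0 ?expR_ge0 ?(ltW e0)//.
  rewrite ler_piMr ?(ltW e0)// -expR0 ler_expR subr0 mulNr oppr_le0.
  by rewrite mulr_ge0// ltW.
suff H : 0 <= 0 - fund (sqd 0 x) - K 0 (sqd p x) + u x.
  have := le_trans H (xmin q Aq).
  have : 0 < K 0 (sqd p q).
    rewrite /K sub0r subr_gt0 ltr_pM2l// ltr_expR !subr0 !mulNr ltrN2 ltr_pM2l//.
    by rewrite sqdE ltrXn2r// ?nnegrE ?enorm_ge0// ltW.
  by lra.
rewrite leNgt; apply/negP; set c := _ + u x => c0.
have [xr xR] := andP Ax.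
move: xr; rewrite le_eqVlt => /orP[/eqP xr|xr].
  have xd : enorm (x - p) < d by rewrite -xr /r; lra.
  have := dP x Px xd; have := Kle _ (sqd_ge0 p x); move: c0; rewrite /c; lra.
move: xR; rewrite le_eqVlt => /orP[/eqP xR|xR].
  have : K 0 (sqd p x) = 0 by rewrite /K sqdE xR sub0r subrr.
  by have := fu x Px; move: c0; rewrite /c; lra.
have nA : \forall z \near x, A z.
  pose e' := Num.min (enorm (x - p) - r) (R1 - enorm (x - p)).
  apply/nbhs_enormP; exists e'; first by rewrite lt_min !subr_gt0 xr.
  move=> z; rewrite lt_min => /andP[z1 z2]; apply/andP; split.
    have := enorm_triangle z x p; rewrite (enorm_distC x z); lra.
  by have := enorm_triangle x z p; lra.
have s0 := sqd0_gt0 Px.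
have ux : u x = fund (sqd 0 x) + K c (sqd p x) by rewrite /c /K; ring.
have le_u : \forall w \near x, fund (sqd 0 w) + K c (sqd p w) <= u w.
  apply: filterS nA => w /xmin; rewrite -/c /K; lra.
have dF : \forall t \near sqd 0 x, is_derive (t : R) (1 : R) fund (fund1 t).
  have : \forall t \near sqd 0 x, 0 < t by exact: lt_nbhsr.
  by apply: filterS => t; exact: is_derive_fund.
have dK' : \forall t \near sqd p x, is_derive (t : R) (1 : R) (K c) (K1 t).
  by apply: (@filterE _ (nbhs (sqd p x))) => t; exact: dK.
have := u_touch Px ux le_u dF (is_derive_fund1 s0) dK' (dK1 (sqd p x)).
rewrite -/m fund_harmonic// add0r leNgt => /negP; apply.
have -> : 2 * m * K1 (sqd p x) + 4 * sqd p x * (- k * K1 (sqd p x)) =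
    (e * expR (- k * (sqd p x - 0))) * k * (4 * (sqd p x * k) - 2 * m).
  by rewrite /K1; ring.
apply: mulr_gt0; first by apply: mulr_gt0 => //; rewrite mulr_gt0 ?expR_gt0.
rewrite subr_gt0.
have : m <= sqd p x * k.
  rewrite /k mulrCA ler_peMr ?(ltW m0)// ler_pdivlMr ?exprn_gt0// mul1r sqdE.
  by rewrite lerXn2r// ?nnegrE ?enorm_ge0// ltW.
lra.
Qed.

(** From a point y with u > fund a chain of Hopf steps would carry the strict inequality to x, where
    equality holds. *)
Lemma touching_sphere_eq (r : R) x : 0 < r < 1 ->
  (forall x, P x -> fund (sqd 0 x) <= u x) ->
  enorm x = r -> u x = fund (sqd 0 x) ->
  forall y, enorm y = r -> u y = fund (sqd 0 y).
Proof.
move=> /andP[r0 r1] fu xr ux y yr.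
have Py : P y by rewrite /punctured_ball/= yr r0.
apply/le_anti; rewrite fu// andbT leNgt; apply/negP => uy.
(* Around points with r / 2 <= |p| <= r, the bound r / 4 keeps the balls off the origin and (1 - r)
   / 2 keeps them in the unit ball. *)
pose R1 := Num.min (r / 4) ((1 - r) / 2).
have R1r : R1 <= r / 4 by rewrite ge_min lexx.
have R1r' : R1 <= (1 - r) / 2 by rewrite ge_min lexx orbT.
have R10 : 0 < R1 by rewrite lt_min !divr_gt0// subr_gt0.
pose D := (Num.bound (2 * r / (R1 / 2))).+1.
have : fund (sqd 0 x) < u x.
  apply: (@sphere_chain R n r (R1 / 2) D (fun _ p => fund (sqd 0 p) < u p)) yr xr uy => //.
    rewrite -ler_pdivrMr ?divr_gt0//; apply: ltW.
    have := archi_boundP (ltW (divr_gt0 (mulr_gt0 (ltr0n _ 2) r0) (divr_gt0 R10 (ltr0n _ 2)))).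
    by move=> /lt_trans; apply; rewrite ltr_nat.
  move=> _ p q /andP[p1 p2] _ qp; apply: (hopf_step (R1 := R1)) => //; last by lra.
  move=> z zp; have := enorm_triangle0 z p; have := enorm_triangle0 p z.
  by rewrite (enorm_distC p z) /punctured_ball/=; lra.
by rewrite ux ltxx.
Qed.

End StrongMinimumPrinciple.

(** * Hoelder norms and the dichotomy *)

Lemma punctured_ballP (R : realType) n : eball n 1 `\ 0 = @punctured_ball R n.
Proof.
apply/seteqP; split=> x; rewrite /punctured_ball/= enorm_gt0.
  by move=> [x1 /eqP ->].
by move=> /andP[/eqP x0 x1].
Qed.

Lemma open_punctured_ball (R : realType) n : open (@punctured_ball R n).
Proof.
rewrite openE => x /andP[x0 x1]; apply/nbhs_enormP.
exists (Num.min (enorm x) (1 - enorm x)); first by rewrite lt_min x0 subr_gt0.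
move=> z; rewrite lt_min => /andP[z1 z2]; rewrite /punctured_ball/=.
have := enorm_triangle0 z x; have := enorm_triangle0 x z.
by rewrite (enorm_distC x z); lra.
Qed.

Lemma LSC_on_lsc_in (R : realType) n (O : set 'rV[R]_n) (u : 'rV[R]_n -> R) :
  LSC_on O u -> lsc_in O u.
Proof.
move=> lu x a Ox ax; have [|W xW WP] := lu x a; first by rewrite lte_fin.
have : within O (nbhs x) W by rewrite (nbhs_subspace_in Ox); exact: xW.
move=> /nbhs_enormP[d d0 dP]; exists d => // z Oz zx.
by have := WP z (dP z zx Oz); rewrite lte_fin.
Qed.

Lemma ltr_powRN (R : realType) (a c r : R) : 0 < r -> 0 < a -> a < c ->
  c `^ (- r) < a `^ (- r).
Proof.
move=> r0 a0 ac; have c0 := lt_trans a0 ac.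
rewrite !powRN ltf_pV2 ?posrE ?powR_gt0//.
by apply: gt0_ltr_powR; rewrite ?nnegrE ?ltW.
Qed.

Lemma lsc_in_powRN (R : realType) n (O : set 'rV[R]_n) (u : 'rV[R]_n -> R) (p : R) :
  0 < p -> (forall x, O x -> 0 < u x) -> lsc_in O u ->
  usc_in O (fun x => u x `^ (- p)).
Proof.
move=> p0 u0 lu x a Ox xa; have ux := u0 x Ox.
have a0 : 0 < a by rewrite (lt_trans _ xa)// powR_gt0.
have ip : 0 < p^-1 by rewrite invr_gt0.
have aE : (a `^ (- p^-1)) `^ (- p) = a.
  by rewrite -powRrM mulrNN mulVf ?gt_eqF// powRr1// ltW.
have au : a `^ (- p^-1) < u x.
  rewrite ltNge; apply/negP => ua.
  have := ler_powRN (ltW p0) ux ua; rewrite aE; lra.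
have [d d0 dP] := lu x _ Ox au; exists d => // z Oz zx.
rewrite -[ltRHS]aE; apply: ltr_powRN => //; first by rewrite powR_gt0.
exact: dP.
Qed.

Lemma powR_small (R : realType) (L b e : R) : 0 <= L -> 0 < b -> 0 < e ->
  exists2 d, 0 < d & forall t, 0 <= t -> t < d -> L * t `^ b < e.
Proof.
move=> L0 b0 e0; have L1 : 0 < L + 1 by rewrite ltr_wpDl.
exists ((e / (L + 1)) `^ b^-1); first by rewrite powR_gt0// divr_gt0.
move=> t t0 td.
have : t `^ b < e / (L + 1).
  have -> : e / (L + 1) = ((e / (L + 1)) `^ b^-1) `^ b.
    by rewrite -powRrM mulVf ?gt_eqF// powRr1// divr_ge0 ?ltW.
  by rewrite gt0_ltr_powR// nnegrE// powR_ge0.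
rewrite ltr_pdivlMr//; apply: le_lt_trans.
by rewrite mulrC ler_wpM2l ?powR_ge0//; lra.
Qed.

Lemma powRN_lipschitz (R : realType) (p c s t : R) : 0 < p -> 0 < c ->
  c <= s -> c <= t -> `|s `^ (- p) - t `^ (- p)| <= p * c `^ (- p - 1) * `|s - t|.
Proof.
move=> p0 c0.
wlog st : s t / s < t.
  move=> H cs ct; have [st|ts|->] := ltgtP s t; first exact: H.
    by rewrite distrC [`|s - t|]distrC; apply: H.
  by rewrite !subrr normr0 mulr0.
move=> cs ct; have s0 := lt_le_trans c0 cs.
have D (z : R) : 0 < z -> is_derive z (1 : R) (fun x : R => x `^ (- p)) (- p * z `^ (- p - 1)).
  exact: is_derive1_powR.
have [|||z] := @MVT R (fun x : R => x `^ (- p)) (fun z => - p * z `^ (- p - 1)) s t.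
- exact: st.
- by move=> z /[!in_itv]/= /andP[sz _]; apply: D; exact: lt_trans sz.
- apply: derivable_within_continuous => z /[!in_itv]/= /andP[sz _].
  by have [] := D z (lt_le_trans s0 sz).
rewrite in_itv/= => /andP[sz zt] E.
have z0 := lt_trans s0 sz.
rewrite distrC E normrM distrC [`|s - t|]distrC ler_wpM2r//.
rewrite normrM normrN (gtr0_norm p0) ger0_norm ?powR_ge0// ler_pM2l//.
have -> : - p - 1 = - (p + 1) by ring.
by apply: ler_powRN => //; [rewrite addr_ge0// ltW|exact: le_trans cs (ltW sz)].
Qed.

Section HolderNorm.
Variables (R : realType) (n : nat) (a : R) (A : set 'rV[R]_n) (f : 'rV[R]_n -> R).

Lemma holder_norm_le B L : 0 <= L -> (forall x, A x -> `|f x| <= B) ->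
  (forall x y, A x -> A y -> `|f x - f y| <= L * enorm (x - y) `^ a) ->
  (holder_norm a A f <= (B + L)%:E)%E.
Proof.
move=> L0 fB fL; rewrite EFinD; apply: leeD; apply: ge_ereal_sup.
  by move=> _ [x Ax <-]; rewrite lee_fin fB.
move=> _ [[x y] [/= Ax Ay] <-]; rewrite lee_fin.
have [->|xy] := eqVneq x y; first by rewrite subrr normr0 mul0r.
by rewrite ler_pdivrMr ?fL// powR_gt0// enorm_gt0 subr_eq0.
Qed.

(** The point x0 makes both suprema nonnegative, so that a finite sum forces a finite seminorm. *)
Lemma holder_norm_fin x0 : A x0 -> (holder_norm a A f < +oo)%E ->
  exists2 L, 0 <= L & forall x y, A x -> A y -> `|f x - f y| <= L * enorm (x - y) `^ a.
Proof.
move=> Ax0; rewrite /holder_norm.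
set E1 := ereal_sup _; set E2 := ereal_sup _.
have E10 : (0 <= E1)%E.
  apply: (@le_trans _ _ (`|f x0|%:E)%E); first by rewrite lee_fin.
  by apply: ereal_sup_ubound; exists x0.
have E20 : (0 <= E2)%E.
  apply: (@le_trans _ _ (`|f x0 - f x0| / enorm (x0 - x0) `^ a)%:E).
    by rewrite lee_fin subrr normr0 mul0r.
  by apply: ereal_sup_ubound; exists (x0, x0).
move=> H; have : (E2 < +oo)%E by apply: le_lt_trans H; rewrite leeDr.
case E2E : E2 E20 => [L| |]// L0 _; rewrite lee_fin in L0; exists L => // x y Ax Ay.
have [->|xy] := eqVneq x y; first by rewrite !subrr normr0 mulr_ge0// powR_ge0.
rewrite -ler_pdivrMr ?powR_gt0 ?enorm_gt0 ?subr_eq0// -lee_fin -E2E.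
by apply: ereal_sup_ubound; exists (x, y).
Qed.

End HolderNorm.

(** This inclusion bounds a supremum over the boundary from below by the value at a single point of
    the sphere. *)
Lemma sphere_boundary (R : realType) n (r : R) (x : 'rV[R]_n) :
  0 < r -> enorm x = r -> boundary (eball n r) x.
Proof.
move=> r0 xr; split; last first.
  by move=> /interior_subset; rewrite /eball/= xr ltxx.
move=> B /nbhs_enormP[d d0 dB].
pose t := Num.min 2^-1 (d / (2 * r)).
have t0 : 0 < t by rewrite lt_min invr_gt0 ltr0n divr_gt0// mulr_gt0.
have t1 : t <= 2^-1 by rewrite ge_min lexx.
have td : t * r < d.
  have : t <= d / (2 * r) by rewrite ge_min lexx orbT.
  by rewrite ler_pdivlMr ?mulr_gt0//; lra.
exists ((1 - t) *: x); split.
  by rewrite /eball/= enormZ xr ger0_norm ?gtr_pMl//; lra.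
apply: dB; have -> : (1 - t) *: x - x = - (t *: x).
  by rewrite scalerBl scale1r addrAC subrr add0r.
by rewrite enormN enormZ xr gtr0_norm.
Qed.

Lemma compact_in_eball (R : realType) n (K : set 'rV[R]_n) :
  compact K -> K `<=` eball n 1 ->
  exists r, 0 < r < 1 /\ forall x, K x -> enorm x <= r.
Proof.
move=> cK K1; have [K0|/set0P/negP/negPn/eqP K0] := pselect (K !=set0); last first.
  by exists 2^-1; split; [lra|move=> x; rewrite K0].
have L : lsc_in K (fun x => - enorm x).
  move=> x a Kx ax; exists (- enorm x - a); first by lra.
  by move=> z _ zx; have := enorm_triangle0 z x; lra.
have [x Kx xmax] := lsc_in_min cK K0 L.
exists ((1 + enorm x) / 2); have := enorm_ge0 x; have := K1 x Kx; rewrite /eball/= => x1 x0.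
by split; [lra|move=> z /xmax; lra].
Qed.

Lemma eq_at_origin (R : realType) n (f g : 'rV[R]_n.+2 -> R) :
  (forall x, 0 < enorm x < 1 -> f x = g x) ->
  (forall e, 0 < e -> exists2 d, 0 < d & forall x, enorm x < d -> `|f x - f 0| < e) ->
  (forall e, 0 < e -> exists2 d, 0 < d & forall x, enorm x < d -> `|g x - g 0| < e) ->
  f 0 = g 0.
Proof.
move=> fg cf cg; apply/eqP; rewrite -subr_eq0 -normr_eq0 -[_ == 0]negbK.
apply/negP => fg0; have e0 : 0 < `|f 0 - g 0| / 2 by rewrite divr_gt0// lt_def fg0/=.
have [d1 d10 d1P] := cf _ e0; have [d2 d20 d2P] := cg _ e0.
pose d := Num.min 2^-1 (Num.min d1 d2) / 2.
have d0 : 0 < d by rewrite divr_gt0// !lt_min invr_gt0 ltr0n d10.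
have dd1 : d < d1.
  have : Num.min 2^-1 (Num.min d1 d2) <= d1 by rewrite !ge_min lexx orbT.
  by rewrite /d; lra.
have dd2 : d < d2.
  have : Num.min 2^-1 (Num.min d1 d2) <= d2 by rewrite !ge_min lexx !orbT.
  by rewrite /d; lra.
have d1' : d < 1.
  have : Num.min 2^-1 (Num.min d1 d2) <= 2^-1 by rewrite !ge_min lexx.
  by rewrite /d; lra.
have [x xd _] := orthogonal_on_sphere (0 : 'rV[R]_n.+2) d0.
have := d1P x; have := d2P x; rewrite xd => /(_ dd2) h2 /(_ dd1) h1.
have E : f x = g x by apply: fg; rewrite xd d0.
have := ler_distD (f x) (f 0) (g 0); rewrite [`|f 0 - f x|]distrC {2}E; lra.
Qed.

(** * The two cases, according to the value v0 at the origin *)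

Section Dichotomy.
Variables (R : realType) (n : nat) (b : R) (u : 'rV[R]_n.+2 -> R).
Local Notation P := (@punctured_ball R n.+2).
Let p : R := b / n%:R.
Let V x := u x `^ (- p).
Hypotheses (n_gt0 : (0 < n)%N) (b_gt0 : 0 < b) (b_le1 : b <= 1)
  (u_gt0 : forall x, P x -> 0 < u x) (u_lsc : lsc_in P u)
  (V_touch : radial_touching b P V) (u_touch : laplace_touching P u).
Implicit Types x y : 'rV[R]_n.+2.

Let n0 : 0 < n%:R :> R.
Proof. by rewrite ltr0n. Qed.

Let p_gt0 : 0 < p.
Proof. exact: divr_gt0. Qed.

Let V_gt0 x : P x -> 0 < V x.
Proof. by move=> Px; rewrite powR_gt0// u_gt0. Qed.

Let V_usc : usc_in P V.
Proof. exact: lsc_in_powRN. Qed.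

Let uV x : P x -> u x = V x `^ (- p^-1).
Proof.
by move=> /u_gt0 ux; rewrite /V -powRrM mulrNN divff ?gt_eqF// powRr1// ltW.
Qed.

Lemma vanishing_center : center_value V = 0 ->
  exists c : R, 0 < c /\ forall x, P x -> u x = c / enorm x ^+ n.
Proof.
move=> v0; pose c := sphere_sup V 2^-1 / 2^-1 `^ b.
have h01 : 0 < (2^-1 : R) < 1 by lra.
have c0 : 0 < c by rewrite divr_gt0 ?powR_gt0 ?(sphere_sup_gt0 V_gt0 V_usc).
have SE r : 0 < r < 1 -> sphere_sup V r = c * r `^ b.
  move=> r01; rewrite (sphere_sup_homogeneous b_le1 V_gt0 V_usc V_touch v0 r01 h01).
  by have [r0 _] := andP r01; rewrite powR_div ?(ltW r0)// /c; ring.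
pose C := c `^ (- p^-1); have C0 : 0 < C by rewrite powR_gt0.
(* The exponents agree because b / p = n. *)
have fundE x : P x -> (c * enorm x `^ b) `^ (- p^-1) = fund n C (sqd 0 x).
  move=> /andP[x0 _]; rewrite powRM ?powR_ge0 ?(ltW c0)// /fund; congr (_ * _).
  rewrite sqdE subr0 -mulNr sqr_powR_half ?(ltW x0)// -powRrM; congr (_ `^ _).
  by rewrite /p; field; rewrite !gt_eqF.
have fu x : P x -> fund n C (sqd 0 x) <= u x.
  move=> Px; rewrite -fundE// (uV Px); apply: ler_powRN.
  - by rewrite invr_ge0 ltW.
  - exact: V_gt0.
  - by rewrite -SE//; exact: (sphere_supP V_usc Px).2.
exists C; split=> // x Px.
(* A maximum point of V on the sphere is a point where u touches the fundamental solution; C is the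
   same for all spheres. *)
have [[z zx Vz] _] := sphere_supP V_usc Px.
have Pz : P z by rewrite /punctured_ball/= zx.
have uz : u z = fund n C (sqd 0 z).
  by rewrite -(fundE _ Pz) zx -(SE _ Px) -Vz; exact: uV.
rewrite (touching_sphere_eq u_lsc u_touch Px fu zx uz (erefl _)).
have [x0 _] := andP Px.
by rewrite /fund sqdE subr0 -mulNr sqr_powR_half ?(ltW x0)// powR_invn ?(ltW x0).
Qed.

Lemma extension_continuous e : 0 < e -> exists2 d, 0 < d &
  forall x, enorm x < d -> `|extension V x - extension V 0| < e.
Proof.
move=> e0; have S0 : 0 < sphere_sup V (3 / 4) by apply: (sphere_sup_gt0 V_gt0 V_usc); lra.
have L0 : 0 <= holder_cst b 2^-1 (3 / 4) * sphere_sup V (3 / 4).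
  rewrite mulr_ge0 ?(ltW S0)// (le_trans _ (center_le_holder_cst _ _ _))//; try lra.
  by rewrite ltW// center_cst_gt0//; lra.
have [d d0 dP] := powR_small L0 b_gt0 e0.
exists (Num.min d 2^-1); first by rewrite lt_min d0; lra.
move=> x; rewrite lt_min => /andP[xd x2]; apply: le_lt_trans (dP _ (enorm_ge0 x) xd).
have := extension_holder b_gt0 b_le1 V_gt0 V_usc V_touch (r := 2^-1) (r' := 3 / 4)
  (x := x) (y := 0).
by rewrite subr0 enorm0; apply; lra.
Qed.

(** Since v0 > 0, the extension W of V is positive at the origin too and has a positive minimum on
    each nonempty compact K. Above that minimum t^(-1/p) is Lipschitz, which carries the Hoelder
    bound over to v. *)
Lemma positive_center : 0 < center_value V ->
  exists v, positive_holder_extension b u v.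
Proof.
move=> v0; pose W := extension V.
have W_gt0 x : eball n.+2 1 x -> 0 < W x.
  rewrite /W /extension => x1; case: eqVneq => // x0.
  by apply: V_gt0; rewrite /punctured_ball/= enorm_gt0 x0.
exists (fun x => W x `^ (- p^-1)); split.
- move=> x; rewrite punctured_ballP => Px; rewrite uV// /W /extension.
  have [x0 _] := andP Px.
  by rewrite enorm_gt0 in x0; rewrite (negbTE x0).
- by move=> x /W_gt0 W0; rewrite powR_gt0.
move=> K cK K1; have [K0|/set0P/negP/negPn/eqP K0] := pselect (K !=set0); last first.
  (* On the empty set both suprema are -oo. *)
  rewrite K0 /holder_norm !image_set0 ereal_sup0 addNye; exact: lt_trans ltNy0 lt0y.
have [r [/andP[r0 r1] Kr]] := compact_in_eball cK K1.
pose r' := (1 + r) / 2; have rr' : r < r' by rewrite /r'; lra.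
have r'1 : r' < 1 by rewrite /r'; lra.
pose L := holder_cst b r r' * sphere_sup V r'.
have WL x y : K x -> K y -> `|W x - W y| <= L * enorm (x - y) `^ b.
  by move=> /Kr xr /Kr yr; apply: extension_holder => //.
have L0 : 0 <= L.
  have S0 : 0 < sphere_sup V r' by apply: (sphere_sup_gt0 V_gt0 V_usc); rewrite /r'; lra.
  rewrite mulr_ge0 ?(ltW S0)// (le_trans _ (center_le_holder_cst _ r0 rr'))//.
  by rewrite ltW// center_cst_gt0// (lt_trans r0).
have W_lsc : lsc_in K W.
  move=> x a Kx ax; have e0 : 0 < W x - a by rewrite subr_gt0.
  have [d d0 dP] := powR_small L0 b_gt0 e0; exists d => // z Kz zx.
  have := dP _ (enorm_ge0 _) zx; have := WL _ _ Kz Kx.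
  by rewrite ler_norml => /andP[+ _]; lra.
have [x0 Kx0 Wmin] := lsc_in_min cK K0 W_lsc.
have c0 := W_gt0 _ (K1 _ Kx0).
have ip0 : 0 < p^-1 by rewrite invr_gt0.
pose M := p^-1 * W x0 `^ (- p^-1 - 1).
have M0 : 0 <= M by rewrite mulr_ge0 ?powR_ge0// ltW.
apply: le_lt_trans (holder_norm_le (B := W x0 `^ (- p^-1)) (L := M * L) _ _ _) (ltry _).
- exact: mulr_ge0.
- move=> x Kx; rewrite (ger0_norm (powR_ge0 _ _)).
  exact: ler_powRN (ltW ip0) c0 (Wmin _ Kx).
- move=> x y Kx Ky; rewrite -mulrA.
  apply: le_trans (powRN_lipschitz ip0 c0 (Wmin _ Kx) (Wmin _ Ky)) _.
  by rewrite -/M ler_wpM2l// WL.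
Qed.

(** The value of v at the origin is determined by continuity, which the Hoelder bound on the closed
    ball of radius 1/2 provides. The estimate for an arbitrary v thus reduces to the constructed
    extension of V. *)
Lemma extension_unique v : positive_holder_extension b u v ->
  forall x, eball n.+2 1 x -> v x `^ (- p) = extension V x.
Proof.
move=> [vu v0 vh]; have vV x : 0 < enorm x < 1 -> v x `^ (- p) = extension V x.
  move=> x01; have [x0 _] := andP x01; rewrite enorm_gt0 in x0.
  by rewrite /extension (negbTE x0) /V vu// punctured_ballP.
move=> x x1; have [->|x0] := eqVneq x 0; last by apply: vV; rewrite enorm_gt0 x0.
apply: (eq_at_origin vV); last exact: extension_continuous.
move=> e e0.
have v00 : 0 < v 0 by apply: v0; rewrite /eball/= enorm0.
have cp : continuous_at (v 0) (fun t : R => t `^ (- p)).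
  have [dp _] := is_derive1_powR (- p) v00.
  by apply: differentiable_continuous; exact/derivable1_diffP.
move: cp => /cvgrPdist_lt/(_ _ e0)/nbhs_ballP[d1/= d10 d1P].
pose K := [set x : 'rV[R]_n.+2 | 0 <= enorm (x - 0) <= 2^-1].
have K0 : K 0 by rewrite /K/= subrr enorm0 lexx/=; lra.
have KP z : K z <-> enorm z <= 2^-1 by rewrite /K/= subr0 enorm_ge0.
have K1 : K `<=` eball n.+2 1.
  by move=> z /KP z2; rewrite /eball/=; apply: le_lt_trans z2 _; lra.
have [L L0 LP] := holder_norm_fin K0 (vh K (@compact_annulus _ _ 0 0 2^-1) K1).
have [d2 d20 d2P] := powR_small L0 b_gt0 d10.
exists (Num.min d2 2^-1); first by rewrite lt_min d20; lra.
move=> z; rewrite lt_min => /andP[z1 z2]; rewrite distrC; apply: d1P.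
rewrite -ball_normE/= distrC; apply: le_lt_trans (LP z 0 _ K0) _.
  by apply/KP/ltW.
by rewrite subr0; apply: d2P; rewrite ?enorm_ge0.
Qed.

(** The sup part is at most S(3/4) by monotonicity, the seminorm at most L S(3/4), and S(3/4) is a
    value of the function on the boundary sphere. *)
Lemma extension_bound v : positive_holder_extension b u v ->
  (holder_norm b (eball n.+2 2^-1) (fun x => (v x `^ (- p))%R) <=
   (1 + holder_cst b 2^-1 (3 / 4))%:E *
     ereal_sup [set (v x `^ (- p))%R%:E | x in boundary (eball n.+2 (3 / 4))])%E.
Proof.
move=> hv; have vW := extension_unique hv.
have h01 : 0 < (3 / 4 : R) < 1 by lra.
pose M := sphere_sup V (3 / 4); have M0 : 0 < M by exact: (sphere_sup_gt0 V_gt0 V_usc).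
set L := holder_cst _ _ _.
have L0 : 0 <= L.
  rewrite (le_trans _ (center_le_holder_cst _ _ _))//; try lra.
  by rewrite ltW// center_cst_gt0//; lra.
have B1 x : eball n.+2 2^-1 x -> eball n.+2 1 x.
  by rewrite /eball/=; lra.
apply: (@le_trans _ _ (M + L * M)%:E).
  apply: holder_norm_le.
  - by rewrite mulr_ge0// ltW.
  - move=> x x2; rewrite vW; last exact: B1.
    rewrite /extension; case: eqVneq => [_|x0].
      by rewrite ger0_norm ?(center_value_ge0 V_gt0 V_usc)// (center_value_le V_gt0 V_usc).
    rewrite ger0_norm ?powR_ge0//; apply: (le_sphere_sup V_usc V_touch); last by lra.
    by move: x2; rewrite enorm_gt0 x0 /eball/=; lra.
  - move=> x y x2 y2; rewrite !vW; [|exact: B1|exact: B1].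
    by apply: extension_holder => //; move: x2 y2; rewrite /eball/=; lra.
have -> : M + L * M = (1 + L) * M by ring.
rewrite EFinM; apply: lee_wpmul2l; first by rewrite lee_fin; lra.
have [[x xr Vx] _] := sphere_supP V_usc h01.
apply: ereal_sup_ubound; exists x; first by apply: sphere_boundary => //; lra.
rewrite vW; last by rewrite /eball/= xr; lra.
have : 0 < enorm x by rewrite xr; lra.
by rewrite enorm_gt0 /extension => /negbTE ->; rewrite Vx.
Qed.

End Dichotomy.

Unset Implicit Arguments.

Theorem theorem1p4 (R : realType) (n : nat) (G : set 'rV[R]_n) (mu : R)
  (n_ge3 : (3 <= n)%N)
  (G_open : open G)
  (G_convex : convex_set (G : set (convex_lmodType 'rV[R]_n)))
  (G_symmetric : symmetric_set G)
  (G_cone : is_cone G)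
  (G_pos : [set l : 'rV[R]_n | forall i, 0 < l 0 i] `<=` G)
  (G_trace : G `<=` [set l : 'rV[R]_n | 0 < \sum_(i < n) l 0 i])
  (G_axis : boundary G (head_tail n 1 0))
  (mu_plus : is_mu_plus G mu)
  (mu_range : 0 <= mu < 1) :
  exists C : R, 0 < C /\
  forall u : 'rV[R]_n -> R,
    LSC_on (eball n 1 `\ 0) u ->
    Linfty_loc (eball n 1 `\ 0) u ->
    (forall x, (eball n 1 `\ 0) x -> 0 < u x) ->
    viscosity_in G (eball n 1 `\ 0) u ->
    ((exists c : R, 0 < c /\
        forall x, (eball n 1 `\ 0) x -> u x = c / enorm x ^+ (n - 2)) \/
     (exists v : 'rV[R]_n -> R, positive_holder_extension (1 - mu) u v)) /\
    (forall v : 'rV[R]_n -> R, positive_holder_extension (1 - mu) u v ->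
       let w := fun x => v x `^ ((mu - 1) / (n%:R - 2)) in
       (holder_norm (1 - mu) (eball n 2^-1) w
          <= C%:E * ereal_sup [set (w x)%:E | x in boundary (eball n (3 / 4))])%E).
Proof.
(* The dimension becomes n.+2 with n positive: two coordinates are available for orthogonal vectors,
   and dim - 2 is n. *)
case: n G n_ge3 G_open G_convex G_symmetric G_cone G_pos G_trace G_axis mu_plus
  => [|[|n]] // G n_ge3 G_open G_convex G_symmetric G_cone G_pos G_trace G_axis [_ mu_plus].
have [mu_ge0 mu_lt1] := andP mu_range.
have n_gt0 : (0 < n)%N by [].
have b0 : 0 < 1 - mu by rewrite subr_gt0.
have b1 : 1 - mu <= 1 by rewrite gerBl.
exists (1 + holder_cst (1 - mu) 2^-1 (3 / 4)); split.
  rewrite ltr_wpDr// (le_trans _ (center_le_holder_cst b0 _ _))//; try lra.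
  by rewrite ltW// center_cst_gt0//; lra.
move=> u + _; rewrite punctured_ballP => /LSC_on_lsc_in u_lsc u_gt0 visc.
have pE : (mu - 1) / (n.+2%:R - 2) = - ((1 - mu) / n%:R).
  by rewrite -addn2 natrD addrK -opprB mulNr.
have V_touch := power_radial_touching n_ge3 G_open G_convex G_symmetric G_cone G_pos
  G_trace G_axis mu_ge0 mu_plus mu_lt1 (@open_punctured_ball R n.+2) u_gt0 visc.
rewrite pE in V_touch.
have u_touch : laplace_touching (@punctured_ball R n.+2) u.
  move=> y z F F1 F2 K K1 K2 x Px.
  exact: (laplace_touch n_ge3 G_convex G_cone G_pos G_trace visc Px (u_gt0 x Px)).
split; last first.
  move=> v hv; rewrite pE /=.
  exact: (extension_bound n_gt0 b0 b1 u_gt0 u_lsc V_touch hv).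
rewrite subn2/=.
have [v0|v0] := eqVneq (center_value (fun x => u x `^ (- ((1 - mu) / n%:R)))) 0.
  by left; exact: (vanishing_center n_gt0 b0 b1 u_gt0 u_lsc V_touch u_touch v0).
right; apply: (positive_center n_gt0 b0 b1 u_gt0 u_lsc V_touch).
rewrite lt_def v0 /=; apply: center_value_ge0.
  by move=> x Px; rewrite powR_gt0// u_gt0.
by apply: lsc_in_powRN => //; rewrite divr_gt0// ltr0n.
Qed.
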